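(* (Three Subobjects Lemma for normal subobjects) If $K$, $L$ and $M$ are normal subobjects of an object $X$ in an algebraically coherent semi-abelian category, then $$[K,L,M]=[[K,L],M]\vee[[M,K],L]$$ as subobjects of $X$. In particular, $[[L,M],K]\leq[[K,L],M]\vee[[M,K],L]$.
   Context: A category is semi-abelian if it is pointed, Barr exact, protomodular and has binary coproducts. A category is protomodular if it has pullbacks of split epimorphisms along any map and all change-of-base functors between its categories of points (defined below) reflect isomorphisms. A normal subobject is a kernel; $\vee$ denotes the join of subobjects. A cospan $(f\colon X\to Z,\ g\colon Y\to Z)$ in a category with finite limits is jointly strongly epimorphic if every monomorphism into $Z$ through which both $f$ and $g$ factor is an isomorphism. A functor between categories with finite limits is coherent if it preserves finite limits and jointly strongly epimorphic pairs. $\mathsf{Pt}_X(\mathcal{C})$ is the category of points over $X$: objects are triples $(A,\ p\colon A\to X,\ s\colon X\to A)$ with $ps=1_X$, and morphisms are morphisms between the objects $A$ commuting with the $p$'s and the $s$'s. For $f\colon X\to Y$, the change-of-base functor $f^*\colon \mathsf{Pt}_Y(\mathcal{C})\to\mathsf{Pt}_X(\mathcal{C})$ is pulling back along $f$. A category $\mathcal{C}$ with finite limits is algebraically coherent if $f^*$ is coherent for every morphism $f$ of $\mathcal{C}$. Binary (Higgins) commutator: for objects $K,L$ let $\iota_{K,L}\colon K\diamond L\to K+L$ be the kernel of the canonical morphism $K+L\to K\times L$; $\diamond$ is functorial in both variables. For subobjects $k\colon K\to X$, $l\colon L\to X$, $[K,L]\leq X$ is the regular image of the composite of $\iota_{K,L}$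 with the morphism $K+L\to X$ induced by $k$ and $l$. Ternary commutator: $K\diamond L\diamond M$ is the kernel of the morphism $(K+L)\diamond M\to(K\diamond M)\times(L\diamond M)$ whose components are obtained by applying $(-)\diamond M$ to the morphisms $K+L\to K$ (identity on $K$, zero on $L$) and $K+L\to L$ (zero on $K$, identity on $L$). Let $\iota_{K,L,M}\colon K\diamond L\diamond M\to K+L+M$ be the composite of this kernel with $\iota_{K+L,M}\colon(K+L)\diamond M\to K+L+M$. For subobjects $k,l,m$ of $X$ with domains $K,L,M$, the ternary commutator $[K,L,M]\leq X$ is the regular image of the composite of $\iota_{K,L,M}$ with the morphism $K+L+M\to X$ induced by $k,l,m$. *)

(* Defs.v *)
From Stdlib Require Import ssreflect List FinFun ClassicalEpsilon ProofIrrelevance.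

Set Implicit Arguments.
Unset Strict Implicit.
Unset Printing Implicit Defensive.

Definition choose {A : Type} (H : inhabited A) : A := epsilon H (fun _ => True).

Lemma the_exists {A : Type} {P : A -> Prop} : (exists! x, P x) -> exists x, P x.
Proof. by case=> x [Px _]; exists x. Qed.

Definition the {A : Type} {P : A -> Prop} (H : exists! x, P x) : A :=
  proj1_sig (constructive_indefinite_description P (the_exists H)).

Lemma theP {A : Type} {P : A -> Prop} (H : exists! x, P x) : P (the H).
Proof. exact: proj2_sig (constructive_indefinite_description P (the_exists H)). Qed.

Lemma unique_eq {A : Type} {P : A -> Prop} :
  (exists! x, P x) -> forall x y, P x -> P y -> x = y.
Proof. by case=> z [_ U] x y Px Py; rewrite -(U x Px) -(U y Py). Qed.

Declare Scope cat_scope.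
Open Scope cat_scope.

Record Category := {
  ob :> Type;
  hom : ob -> ob -> Type;
  idm : forall X, hom X X;
  comp : forall X Y Z, hom Y Z -> hom X Y -> hom X Z;
  comp_idl : forall X Y (f : hom X Y), comp (idm Y) f = f;
  comp_idr : forall X Y (f : hom X Y), comp f (idm X) = f;
  comp_assoc : forall X Y Z W (h : hom Z W) (g : hom Y Z) (f : hom X Y),
    comp h (comp g f) = comp (comp h g) f
}.

Arguments hom {_} _ _.
Arguments idm {_} _.
Arguments comp {_ _ _ _} _ _.

Notation "X ~> Y" := (hom X Y) (at level 90, no associativity) : cat_scope.
Notation "g ∘ f" := (comp g f) (at level 40, left associativity) : cat_scope.
Notation "1_ X" := (idm X) (at level 8, X at level 2, format "1_ X") : cat_scope.

Record Functor (C D : Category) := {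
  fob :> C -> D;
  fmap : forall X Y, (X ~> Y) -> (fob X ~> fob Y);
  fmap_id : forall X, fmap (1_X) = 1_(fob X);
  fmap_comp : forall X Y Z (g : Y ~> Z) (f : X ~> Y),
    fmap (g ∘ f) = fmap g ∘ fmap f
}.

Arguments fmap {_ _} _ {_ _} _.

Lemma functor_comp_id (C D E : Category) (G : Functor D E) (F : Functor C D) X :
  fmap G (fmap F (1_X)) = 1_(G (F X)).
Proof. by rewrite !fmap_id. Qed.

Lemma functor_comp_comp (C D E : Category) (G : Functor D E) (F : Functor C D)
    X Y Z (g : Y ~> Z) (f : X ~> Y) :
  fmap G (fmap F (g ∘ f)) = fmap G (fmap F g) ∘ fmap G (fmap F f).
Proof. by rewrite !fmap_comp. Qed.

Definition functor_comp (C D E : Category) (G : Functor D E) (F : Functor C D) :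
    Functor C E :=
  {| fob := fun X => G (F X);
     fmap := fun X Y f => fmap G (fmap F f);
     fmap_id := functor_comp_id G F;
     fmap_comp := functor_comp_comp G F |}.

Record Cone (J C : Category) (D : Functor J C) := {
  apex : C;
  leg : forall j, apex ~> D j;
  leg_natural : forall i j (a : i ~> j), fmap D a ∘ leg i = leg j
}.

Arguments apex {_ _ _} _.
Arguments leg {_ _ _} _ _.

Definition is_limit (J C : Category) (D : Functor J C) (c : Cone D) : Prop :=
  forall c' : Cone D, exists! u : apex c' ~> apex c, forall j, leg c j ∘ u = leg c' j.

Lemma map_cone_natural (J C E : Category) (F : Functor C E) (D : Functor J C)
    (c : Cone D) i j (a : i ~> j) :
  fmap (functor_comp F D) a ∘ fmap F (leg c i) = fmap F (leg c j).
Proof. by rewrite /= -fmap_comp leg_natural. Qed.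

Definition map_cone (J C E : Category) (F : Functor C E) (D : Functor J C)
    (c : Cone D) : Cone (functor_comp F D) :=
  {| apex := F (apex c);
     leg := (fun j => fmap F (leg c j)) : forall j, F (apex c) ~> functor_comp F D j;
     leg_natural := @map_cone_natural J C E F D c |}.

Definition finite_category (J : Category) : Prop :=
  Finite J /\ forall i j : J, Finite (i ~> j).

Definition has_finite_limits (C : Category) : Prop :=
  forall (J : Category) (D : Functor J C), finite_category J ->
    exists c : Cone D, is_limit c.

Definition preserves_finite_limits (C E : Category) (F : Functor C E) : Prop :=
  forall (J : Category) (D : Functor J C) (c : Cone D), finite_category J ->
    is_limit c -> is_limit (map_cone F c).

Section Morphisms.
Context {C : Category}.

Definition iso {X Y : C} (f : X ~> Y) : Prop :=
  exists g : Y ~> X, g ∘ f = 1_X /\ f ∘ g = 1_Y.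

Definition mono {X Y : C} (f : X ~> Y) : Prop :=
  forall T (u v : T ~> X), f ∘ u = f ∘ v -> u = v.

Definition jointly_strongly_epic {X Y Z : C} (f : X ~> Z) (g : Y ~> Z) : Prop :=
  forall (M : C) (m : M ~> Z), mono m ->
    (exists f', f = m ∘ f') -> (exists g', g = m ∘ g') -> iso m.

Definition is_pullback {X Y Z P : C} (f : X ~> Z) (g : Y ~> Z)
    (p : P ~> X) (q : P ~> Y) : Prop :=
  f ∘ p = g ∘ q /\
  forall T (a : T ~> X) (b : T ~> Y), f ∘ a = g ∘ b ->
    exists! u : T ~> P, p ∘ u = a /\ q ∘ u = b.

Definition is_product {X Y P : C} (p : P ~> X) (q : P ~> Y) : Prop :=
  forall T (a : T ~> X) (b : T ~> Y), exists! u : T ~> P, p ∘ u = a /\ q ∘ u = b.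

Definition is_coproduct {X Y S : C} (i : X ~> S) (j : Y ~> S) : Prop :=
  forall T (a : X ~> T) (b : Y ~> T), exists! u : S ~> T, u ∘ i = a /\ u ∘ j = b.

Definition is_coequalizer {R X Q : C} (a b : R ~> X) (q : X ~> Q) : Prop :=
  q ∘ a = q ∘ b /\
  forall T (h : X ~> T), h ∘ a = h ∘ b -> exists! u : Q ~> T, u ∘ q = h.

Definition regular_epi {X Q : C} (q : X ~> Q) : Prop :=
  exists (R : C) (a b : R ~> X), is_coequalizer a b q.

Definition is_kernel_pair {R X Y : C} (f : X ~> Y) (a b : R ~> X) : Prop :=
  is_pullback f f a b.

Definition equivalence_relation {R X : C} (r1 r2 : R ~> X) : Prop :=
  (forall T (u v : T ~> R), r1 ∘ u = r1 ∘ v -> r2 ∘ u = r2 ∘ v -> u = v) /\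
  (exists d : X ~> R, r1 ∘ d = 1_X /\ r2 ∘ d = 1_X) /\
  (exists s : R ~> R, r1 ∘ s = r2 /\ r2 ∘ s = r1) /\
  (forall (P : C) (p q : P ~> R), is_pullback r2 r1 p q ->
     exists t : P ~> R, r1 ∘ t = r1 ∘ p /\ r2 ∘ t = r2 ∘ q).

Definition zero_object (Z : C) : Prop :=
  (forall X, exists! f : X ~> Z, True) /\ (forall X, exists! f : Z ~> X, True).

Record Pullback {X Y Z : C} (f : X ~> Z) (g : Y ~> Z) := {
  pb_ob : C;
  pb1 : pb_ob ~> X;
  pb2 : pb_ob ~> Y;
  pbP : is_pullback f g pb1 pb2
}.

Record Product (X Y : C) := {
  prod_ob : C;
  pr1 : prod_ob ~> X;
  pr2 : prod_ob ~> Y;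
  prodP : is_product pr1 pr2
}.

Record Coproduct (X Y : C) := {
  coprod_ob : C;
  in1 : X ~> coprod_ob;
  in2 : Y ~> coprod_ob;
  coprodP : is_coproduct in1 in2
}.

End Morphisms.

Arguments pb_ob {_ _ _ _ _ _} _.
Arguments pb1 {_ _ _ _ _ _} _.
Arguments pb2 {_ _ _ _ _ _} _.
Arguments pbP {_ _ _ _ _ _} _.

Section PullbackLift.
Context {C : Category} {X Y Z : C} {f : X ~> Z} {g : Y ~> Z} (P : Pullback f g).

Definition pb_lift {T : C} {a : T ~> X} {b : T ~> Y} (e : f ∘ a = g ∘ b) :
  T ~> pb_ob P := the (proj2 (pbP P) T a b e).

Lemma pb_lift1 {T : C} {a : T ~> X} {b : T ~> Y} (e : f ∘ a = g ∘ b) :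
  pb1 P ∘ pb_lift e = a.
Proof. exact: proj1 (theP (proj2 (pbP P) T a b e)). Qed.

Lemma pb_lift2 {T : C} {a : T ~> X} {b : T ~> Y} (e : f ∘ a = g ∘ b) :
  pb2 P ∘ pb_lift e = b.
Proof. exact: proj2 (theP (proj2 (pbP P) T a b e)). Qed.

Lemma pb_comm : f ∘ pb1 P = g ∘ pb2 P.
Proof. exact: proj1 (pbP P). Qed.

Lemma pb_ext {T : C} (u v : T ~> pb_ob P) :
  pb1 P ∘ u = pb1 P ∘ v -> pb2 P ∘ u = pb2 P ∘ v -> u = v.
Proof.
move=> e1 e2.
have e : f ∘ (pb1 P ∘ v) = g ∘ (pb2 P ∘ v) by rewrite !comp_assoc pb_comm.
exact: (unique_eq (proj2 (pbP P) T _ _ e)).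
Qed.

End PullbackLift.

Definition has_pullbacks (C : Category) : Prop :=
  forall (X Y Z : C) (f : X ~> Z) (g : Y ~> Z), inhabited (Pullback f g).

Definition has_split_epi_pullbacks (C : Category) : Prop :=
  forall (X Y A : C) (f : X ~> Y) (p : A ~> Y) (s : Y ~> A),
    p ∘ s = 1_Y -> inhabited (Pullback f p).

Definition has_binary_coproducts (C : Category) : Prop :=
  forall X Y : C, inhabited (Coproduct X Y).

Lemma has_pullbacks_split_epi (C : Category) :
  has_pullbacks C -> has_split_epi_pullbacks C.
Proof. by move=> H X Y A f p s _; exact: H. Qed.

Inductive cospan_ob : Set := cs_left | cs_right | cs_mid.

Definition cospan_hom (i j : cospan_ob) : Set :=
  match i, j with
  | cs_left, cs_left | cs_right, cs_right | cs_mid, cs_mid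
  | cs_left, cs_mid | cs_right, cs_mid => unit
  | _, _ => Empty_set
  end.

Definition cospan_id (i : cospan_ob) : cospan_hom i i :=
  match i with cs_left => tt | cs_right => tt | cs_mid => tt end.

Definition cospan_comp (i j k : cospan_ob) :
  cospan_hom j k -> cospan_hom i j -> cospan_hom i k.
Proof. by case: i; case: j; case: k => // - [] // []. Defined.

Lemma cospan_hom_eq (i j : cospan_ob) (a b : cospan_hom i j) : a = b.
Proof. by move: a b; case: i; case: j => /= - [] []. Qed.

Definition cospan : Category :=
  {| ob := cospan_ob; hom := cospan_hom; idm := cospan_id; comp := cospan_comp;
     comp_idl := fun i j f => cospan_hom_eq _ _;
     comp_idr := fun i j f => cospan_hom_eq _ _;
     comp_assoc := fun i j k l h g f => cospan_hom_eq _ _ |}.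

Lemma cospan_finite : finite_category cospan.
Proof.
split; first by exists (cs_left :: cs_right :: cs_mid :: nil); case=> /=; tauto.
by case; case; (try by exists (tt :: nil); case=> /=; tauto); exists nil; case.
Qed.

Section CospanDiagram.
Context {C : Category} {X Y Z : C} (f : X ~> Z) (g : Y ~> Z).

Definition cospan_diag_ob (i : cospan_ob) : C :=
  match i with cs_left => X | cs_right => Y | cs_mid => Z end.

Definition cospan_diag_map (i j : cospan_ob) :
  cospan_hom i j -> (cospan_diag_ob i ~> cospan_diag_ob j) :=
  match i, j with
  | cs_left, cs_left => fun _ => 1_X
  | cs_right, cs_right => fun _ => 1_Y
  | cs_mid, cs_mid => fun _ => 1_Z
  | cs_left, cs_mid => fun _ => f
  | cs_right, cs_mid => fun _ => g
  | _, _ => fun e : Empty_set => match e with end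
  end.

Lemma cospan_diag_id (i : cospan_ob) :
  cospan_diag_map (cospan_id i) = 1_(cospan_diag_ob i).
Proof. by case: i. Qed.

Lemma cospan_diag_comp (i j k : cospan_ob) (b : cospan_hom j k) (a : cospan_hom i j) :
  cospan_diag_map (cospan_comp b a) = cospan_diag_map b ∘ cospan_diag_map a.
Proof.
by move: a b; case: i; case: j; case: k => /= - [] [] //=; rewrite ?comp_idl ?comp_idr.
Qed.

Definition cospan_diag : Functor cospan C :=
  @Build_Functor cospan C cospan_diag_ob cospan_diag_map
    cospan_diag_id cospan_diag_comp.

Definition cospan_leg {T : C} (a : T ~> X) (b : T ~> Y) (i : cospan) :
  T ~> cospan_diag i :=
  match i with cs_left => a | cs_right => b | cs_mid => f ∘ a end.

Lemma cospan_leg_natural {T : C} (a : T ~> X) (b : T ~> Y) (e : f ∘ a = g ∘ b)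
    (i j : cospan) (x : i ~> j) :
  fmap cospan_diag x ∘ cospan_leg a b i = cospan_leg a b j.
Proof. by move: x; case: i; case: j => /= - [] //=; rewrite ?comp_idl. Qed.

Lemma limit_pullback (c : Cone cospan_diag) :
  is_limit c -> is_pullback f g (leg c cs_left) (leg c cs_right).
Proof.
move=> Hc.
have el := leg_natural c (i := cs_left) (j := cs_mid) tt.
have er := leg_natural c (i := cs_right) (j := cs_mid) tt.
split; first by rewrite [LHS]el -[LHS]er.
move=> T a b e.
case: (Hc (Build_Cone (@cospan_leg_natural T a b e))) => u [Hu Uu].
exists u; split; first by split; [exact: (Hu cs_left) | exact: (Hu cs_right)].
move=> v [v1 v2]; apply: Uu; case => //=.
by rewrite -[leg c cs_mid]el /= -comp_assoc v1.
Qed.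

End CospanDiagram.

Lemma finite_limits_pullbacks (C : Category) : has_finite_limits C -> has_pullbacks C.
Proof.
move=> H X Y Z f g.
case: (H cospan (cospan_diag f g) cospan_finite) => c Hc.
exact: (inhabits (Build_Pullback (limit_pullback Hc))).
Qed.

Record Point {C : Category} (X : C) := {
  pt_ob : C;
  pt_proj : pt_ob ~> X;
  pt_sec : X ~> pt_ob;
  pt_split : pt_proj ∘ pt_sec = 1_X
}.

Arguments pt_ob {_ _} _.
Arguments pt_proj {_ _} _.
Arguments pt_sec {_ _} _.
Arguments pt_split {_ _} _.

Record PointHom {C : Category} {X : C} (A B : Point X) := {
  pt_map : pt_ob A ~> pt_ob B;
  pt_map_proj : pt_proj B ∘ pt_map = pt_proj A;
  pt_map_sec : pt_map ∘ pt_sec A = pt_sec B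
}.

Arguments pt_map {_ _ _ _} _.

Section Points.
Context {C : Category}.

Lemma PointHom_eq {X : C} {A B : Point X} (h k : PointHom A B) :
  pt_map h = pt_map k -> h = k.
Proof.
case: h k => [h h1 h2] [k k1 k2] /= e; subst k.
by rewrite (proof_irrelevance _ h1 k1) (proof_irrelevance _ h2 k2).
Qed.

Definition point_id {X : C} (A : Point X) : PointHom A A :=
  Build_PointHom (comp_idr (pt_proj A)) (comp_idl (pt_sec A)).

Definition point_comp {X : C} (A B D : Point X) (h : PointHom B D) (k : PointHom A B) :
  PointHom A D.
Proof.
exists (pt_map h ∘ pt_map k).
- by rewrite comp_assoc !pt_map_proj.
- by rewrite -comp_assoc !pt_map_sec.
Defined.

Lemma point_idl {X : C} (A B : Point X) (h : PointHom A B) : point_comp (point_id B) h = h.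
Proof. by apply: PointHom_eq; exact: comp_idl. Qed.

Lemma point_idr {X : C} (A B : Point X) (h : PointHom A B) : point_comp h (point_id A) = h.
Proof. by apply: PointHom_eq; exact: comp_idr. Qed.

Lemma point_assoc {X : C} (A B D E : Point X)
    (h : PointHom D E) (g : PointHom B D) (f : PointHom A B) :
  point_comp h (point_comp g f) = point_comp (point_comp h g) f.
Proof. by apply: PointHom_eq; exact: comp_assoc. Qed.

Definition Pt (X : C) : Category :=
  {| ob := Point X; hom := PointHom; idm := point_id; comp := point_comp;
     comp_idl := point_idl; comp_idr := point_idr; comp_assoc := point_assoc |}.

Context (H : has_split_epi_pullbacks C) {X Y : C} (f : X ~> Y).

Definition cob_pb (A : Pt Y) : Pullback f (pt_proj A) := choose (H f (pt_split A)).

Lemma cob_sec_comm (A : Pt Y) : f ∘ 1_X = pt_proj A ∘ (pt_sec A ∘ f).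
Proof. by rewrite comp_assoc pt_split comp_idl comp_idr. Qed.

Definition cob_ob (A : Pt Y) : Pt X :=
  {| pt_ob := pb_ob (cob_pb A);
     pt_proj := pb1 (cob_pb A);
     pt_sec := pb_lift (cob_pb A) (cob_sec_comm A);
     pt_split := pb_lift1 (cob_pb A) (cob_sec_comm A) |}.

Lemma cob_map_comm (A B : Pt Y) (h : A ~> B) :
  f ∘ pb1 (cob_pb A) = pt_proj B ∘ (pt_map h ∘ pb2 (cob_pb A)).
Proof. by rewrite comp_assoc pt_map_proj pb_comm. Qed.

Definition cob_map (A B : Pt Y) (h : A ~> B) : cob_ob A ~> cob_ob B.
Proof.
exists (pb_lift (cob_pb B) (cob_map_comm h)); first exact: pb_lift1.
apply: (pb_ext (P := cob_pb B)); rewrite comp_assoc.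
- by rewrite !pb_lift1.
- by rewrite !pb_lift2 -comp_assoc pb_lift2 comp_assoc pt_map_sec.
Defined.

Lemma cob_id (A : Pt Y) : cob_map (1_A) = 1_(cob_ob A).
Proof.
apply: PointHom_eq; apply: (pb_ext (P := cob_pb A)) => /=.
- by rewrite pb_lift1 comp_idr.
- by rewrite pb_lift2 comp_idr comp_idl.
Qed.

Lemma cob_comp (A B D : Pt Y) (h : B ~> D) (k : A ~> B) :
  cob_map (h ∘ k) = cob_map h ∘ cob_map k.
Proof.
apply: PointHom_eq; apply: (pb_ext (P := cob_pb D)) => /=.
- by rewrite comp_assoc !pb_lift1.
- by rewrite comp_assoc !pb_lift2 -!comp_assoc pb_lift2.
Qed.

Definition change_of_base : Functor (Pt Y) (Pt X) :=
  {| fob := cob_ob; fmap := cob_map; fmap_id := cob_id; fmap_comp := cob_comp |}.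

End Points.

Definition reflects_isos (C D : Category) (F : Functor C D) : Prop :=
  forall (X Y : C) (f : X ~> Y), iso (fmap F f) -> iso f.

Definition preserves_jointly_strongly_epic (C D : Category) (F : Functor C D) : Prop :=
  forall (X Y Z : C) (f : X ~> Z) (g : Y ~> Z),
    jointly_strongly_epic f g -> jointly_strongly_epic (fmap F f) (fmap F g).

(** Only used between categories of points, which inherit finite limits from the
    base category; hence no separate finite-limit hypotheses on [C] and [D]. *)
Definition coherent (C D : Category) (F : Functor C D) : Prop :=
  preserves_finite_limits F /\ preserves_jointly_strongly_epic F.

Definition algebraically_coherent (C : Category) : Prop :=
  exists H : has_finite_limits C, forall (X Y : C) (f : X ~> Y),
    coherent (change_of_base (has_pullbacks_split_epi (finite_limits_pullbacks H)) f).

Definition pointed (C : Category) : Prop := exists Z : C, zero_object Z.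

Definition protomodular (C : Category) : Prop :=
  exists H : has_split_epi_pullbacks C, forall (X Y : C) (f : X ~> Y),
    reflects_isos (change_of_base H f).

Definition regular (C : Category) : Prop :=
  has_finite_limits C /\
  (forall (R X Y : C) (f : X ~> Y) (a b : R ~> X), is_kernel_pair f a b ->
     exists (Q : C) (q : X ~> Q), is_coequalizer a b q) /\
  (forall (P X Y Z : C) (f : X ~> Z) (g : Y ~> Z) (p : P ~> X) (q : P ~> Y),
     is_pullback f g p q -> regular_epi g -> regular_epi p).

Definition barr_exact (C : Category) : Prop :=
  regular C /\
  forall (R X : C) (r1 r2 : R ~> X), equivalence_relation r1 r2 ->
    exists (Y : C) (f : X ~> Y), is_kernel_pair f r1 r2.

Record SemiAbelianCategory := {
  sa_cat :> Category;
  sa_pointed : pointed sa_cat;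
  sa_exact : barr_exact sa_cat;
  sa_protomodular : protomodular sa_cat;
  sa_coproducts : has_binary_coproducts sa_cat
}.

Section SemiAbelian.
Context {C : SemiAbelianCategory}.

Lemma sa_pullbacks : has_pullbacks C.
Proof. exact: finite_limits_pullbacks (proj1 (proj1 (sa_exact C))). Qed.

Definition zero_ob : C :=
  proj1_sig (constructive_indefinite_description _ (sa_pointed C)).

Lemma zero_obP : zero_object zero_ob.
Proof. exact: proj2_sig (constructive_indefinite_description _ (sa_pointed C)). Qed.

Definition to_zero (X : C) : X ~> zero_ob := the (proj1 zero_obP X).
Definition from_zero (X : C) : zero_ob ~> X := the (proj2 zero_obP X).
Definition zero (X Y : C) : X ~> Y := from_zero Y ∘ to_zero X.

Lemma to_zero_eq {X : C} (f g : X ~> zero_ob) : f = g.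
Proof. exact: (unique_eq (proj1 zero_obP X)). Qed.

Lemma from_zero_eq {X : C} (f g : zero_ob ~> X) : f = g.
Proof. exact: (unique_eq (proj2 zero_obP X)). Qed.

Lemma zero_compl {X Y Z : C} (f : X ~> Y) : zero Y Z ∘ f = zero X Z.
Proof. by rewrite /zero -comp_assoc; congr (_ ∘ _); exact: to_zero_eq. Qed.

Lemma zero_compr {X Y Z : C} (f : Y ~> Z) : f ∘ zero X Y = zero X Z.
Proof. by rewrite /zero comp_assoc; congr (_ ∘ _); exact: from_zero_eq. Qed.

Definition is_kernel {K X Y : C} (f : X ~> Y) (k : K ~> X) : Prop :=
  f ∘ k = zero K Y /\
  forall T (h : T ~> X), f ∘ h = zero T Y -> exists! u : T ~> K, k ∘ u = h.

Record Kernel {X Y : C} (f : X ~> Y) := {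
  kernel_ob : C;
  kernel_map : kernel_ob ~> X;
  kernel_mapP : is_kernel f kernel_map
}.

Lemma kernel_exists {X Y : C} (f : X ~> Y) : inhabited (Kernel f).
Proof.
case: (sa_pullbacks f (from_zero Y)) => P.
have Hk : is_kernel f (pb1 P).
  split.
    by rewrite pb_comm /zero; congr (_ ∘ _); exact: to_zero_eq.
  move=> T h e; exists (pb_lift P e); split; first exact: pb_lift1.
  move=> v ev; apply: pb_ext; last exact: to_zero_eq.
  by rewrite pb_lift1 ev.
exact: (inhabits (Build_Kernel Hk)).
Qed.

Definition ker_ob {X Y : C} (f : X ~> Y) : C := kernel_ob (choose (kernel_exists f)).

Definition ker {X Y : C} (f : X ~> Y) : ker_ob f ~> X :=
  kernel_map (choose (kernel_exists f)).

Lemma kerP {X Y : C} (f : X ~> Y) : is_kernel f (ker f).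
Proof. exact: kernel_mapP (choose (kernel_exists f)). Qed.

Definition ker_lift {X Y : C} (f : X ~> Y) {T : C} {h : T ~> X}
    (e : f ∘ h = zero T Y) : T ~> ker_ob f :=
  the (proj2 (kerP f) T h e).

Lemma ker_liftP {X Y : C} (f : X ~> Y) {T : C} {h : T ~> X} (e : f ∘ h = zero T Y) :
  ker f ∘ ker_lift e = h.
Proof. exact: theP (proj2 (kerP f) T h e). Qed.

Lemma product_exists (X Y : C) : inhabited (Product X Y).
Proof.
case: (sa_pullbacks (to_zero X) (to_zero Y)) => P.
have HP : is_product (pb1 P) (pb2 P).
  by move=> T a b; apply: (proj2 (pbP P)); exact: to_zero_eq.
exact: (inhabits (Build_Product HP)).
Qed.

Definition product (X Y : C) : Product X Y := choose (product_exists X Y).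
Definition coproduct (X Y : C) : Coproduct X Y := choose (sa_coproducts X Y).

Notation "X × Y" := (prod_ob (product X Y)) (at level 40, left associativity).
Notation "X ⊕ Y" := (coprod_ob (coproduct X Y)) (at level 50, left associativity).

Definition pair {T X Y : C} (a : T ~> X) (b : T ~> Y) : T ~> X × Y :=
  the (prodP (product X Y) a b).

Definition copair {X Y T : C} (a : X ~> T) (b : Y ~> T) : X ⊕ Y ~> T :=
  the (coprodP (coproduct X Y) a b).

Lemma pair1 {T X Y : C} (a : T ~> X) (b : T ~> Y) : pr1 (product X Y) ∘ pair a b = a.
Proof. exact: proj1 (theP (prodP (product X Y) a b)). Qed.

Lemma pair2 {T X Y : C} (a : T ~> X) (b : T ~> Y) : pr2 (product X Y) ∘ pair a b = b.
Proof. exact: proj2 (theP (prodP (product X Y) a b)). Qed.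

Lemma pair_ext {T X Y : C} (u v : T ~> X × Y) :
  pr1 (product X Y) ∘ u = pr1 (product X Y) ∘ v ->
  pr2 (product X Y) ∘ u = pr2 (product X Y) ∘ v -> u = v.
Proof. by move=> e1 e2; exact: (unique_eq (prodP (product X Y) _ _)). Qed.

Lemma copair1 {X Y T : C} (a : X ~> T) (b : Y ~> T) : copair a b ∘ in1 (coproduct X Y) = a.
Proof. exact: proj1 (theP (coprodP (coproduct X Y) a b)). Qed.

Lemma copair2 {X Y T : C} (a : X ~> T) (b : Y ~> T) : copair a b ∘ in2 (coproduct X Y) = b.
Proof. exact: proj2 (theP (coprodP (coproduct X Y) a b)). Qed.

Lemma copair_ext {X Y T : C} (u v : X ⊕ Y ~> T) :
  u ∘ in1 (coproduct X Y) = v ∘ in1 (coproduct X Y) ->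
  u ∘ in2 (coproduct X Y) = v ∘ in2 (coproduct X Y) -> u = v.
Proof. by move=> e1 e2; exact: (unique_eq (coprodP (coproduct X Y) _ _)). Qed.

Definition coprod_map {X Y X' Y' : C} (f : X ~> X') (g : Y ~> Y') : X ⊕ Y ~> X' ⊕ Y' :=
  copair (in1 (coproduct X' Y') ∘ f) (in2 (coproduct X' Y') ∘ g).

Definition coprod_proj1 (X Y : C) : X ⊕ Y ~> X := copair (1_X) (zero Y X).
Definition coprod_proj2 (X Y : C) : X ⊕ Y ~> Y := copair (zero X Y) (1_Y).

Definition coprod_to_prod (X Y : C) : X ⊕ Y ~> X × Y :=
  pair (coprod_proj1 X Y) (coprod_proj2 X Y).

Definition cosmash (K L : C) : C := ker_ob (coprod_to_prod K L).
Notation "K ◇ L" := (cosmash K L) (at level 40, left associativity).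

Definition iota (K L : C) : K ◇ L ~> K ⊕ L := ker (coprod_to_prod K L).

Lemma cosmash_map_comm {K L K' L' : C} (f : K ~> K') (g : L ~> L') :
  coprod_to_prod K' L' ∘ (coprod_map f g ∘ iota K L) = zero (K ◇ L) (K' × L').
Proof.
have e1 : coprod_proj1 K' L' ∘ coprod_map f g = f ∘ coprod_proj1 K L.
  apply: copair_ext; rewrite -!comp_assoc ?copair1 ?copair2 comp_assoc ?copair1 ?copair2.
    by rewrite comp_idl comp_idr.
  by rewrite zero_compl zero_compr.
have e2 : coprod_proj2 K' L' ∘ coprod_map f g = g ∘ coprod_proj2 K L.
  apply: copair_ext; rewrite -!comp_assoc ?copair1 ?copair2 comp_assoc ?copair1 ?copair2.
    by rewrite zero_compl zero_compr.
  by rewrite comp_idl comp_idr.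
have e0 := proj1 (kerP (coprod_to_prod K L)).
apply: pair_ext; rewrite comp_assoc ?pair1 ?pair2 zero_compr comp_assoc ?e1 ?e2.
  rewrite -(pair1 (coprod_proj1 K L) (coprod_proj2 K L)).
  by rewrite -!comp_assoc e0 !zero_compr.
rewrite -(pair2 (coprod_proj1 K L) (coprod_proj2 K L)).
by rewrite -!comp_assoc e0 !zero_compr.
Qed.

Definition cosmash_map {K L K' L' : C} (f : K ~> K') (g : L ~> L') : K ◇ L ~> K' ◇ L' :=
  ker_lift (cosmash_map_comm f g).

Lemma cosmash_mapP {K L K' L' : C} (f : K ~> K') (g : L ~> L') :
  iota K' L' ∘ cosmash_map f g = coprod_map f g ∘ iota K L.
Proof. exact: ker_liftP. Qed.

Definition cosmash3_map (K L M : C) : (K ⊕ L) ◇ M ~> (K ◇ M) × (L ◇ M) :=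
  pair (cosmash_map (coprod_proj1 K L) (1_M)) (cosmash_map (coprod_proj2 K L) (1_M)).

Definition cosmash3 (K L M : C) : C := ker_ob (cosmash3_map K L M).

Definition iota3 (K L M : C) : cosmash3 K L M ~> K ⊕ L ⊕ M :=
  iota (K ⊕ L) M ∘ ker (cosmash3_map K L M).

Record Sub (X : C) := {
  sub_ob : C;
  sub_map : sub_ob ~> X;
  sub_mono : mono sub_map
}.

Arguments sub_map {_} _.

Definition sub_le {X : C} (A B : Sub X) : Prop :=
  exists h : sub_ob A ~> sub_ob B, sub_map A = sub_map B ∘ h.

(** A [Sub] is a representing monomorphism; two of them are the same subobject
    when each factors through the other. *)
Definition sub_eq {X : C} (A B : Sub X) : Prop := sub_le A B /\ sub_le B A.

Definition normal {X : C} (A : Sub X) : Prop :=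
  exists (Y : C) (f : X ~> Y), is_kernel f (sub_map A).

Definition is_join {X : C} (A B J : Sub X) : Prop :=
  sub_le A J /\ sub_le B J /\ forall D, sub_le A D -> sub_le B D -> sub_le J D.

Definition is_regular_image {X Y : C} (f : X ~> Y) (I : Sub Y) : Prop :=
  exists e : X ~> sub_ob I, regular_epi e /\ f = sub_map I ∘ e.

Lemma regular_epi_epi {X Y : C} (e : X ~> Y) :
  regular_epi e -> forall T (u v : Y ~> T), u ∘ e = v ∘ e -> u = v.
Proof.
case=> R [a [b [ea H]]] T u v euv.
have h : (u ∘ e) ∘ a = (u ∘ e) ∘ b by rewrite -!comp_assoc ea.
exact: (unique_eq (H T _ h)).
Qed.

Lemma regular_image_exists {X Y : C} (f : X ~> Y) : exists I : Sub Y, is_regular_image f I.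
Proof.
case: (proj1 (sa_exact C)) => _ [Hcoeq Hstable].
case: (sa_pullbacks f f) => P.
case: (Hcoeq _ _ _ f _ _ (pbP P)) => Q [q Hq].
have [m [em _]] := proj2 Hq _ f (pb_comm P).
have rq : regular_epi q by exists (pb_ob P), (pb1 P), (pb2 P).
have mm : mono m.
  move=> T u v euv.
  case: (sa_pullbacks u q) => P1.
  case: (sa_pullbacks (v ∘ pb1 P1) q) => P2.
  have r1 : regular_epi (pb1 P1) := Hstable _ _ _ _ _ _ _ _ (pbP P1) rq.
  have r2 : regular_epi (pb1 P2) := Hstable _ _ _ _ _ _ _ _ (pbP P2) rq.
  apply: (regular_epi_epi r1); apply: (regular_epi_epi r2).
  have e : f ∘ (pb2 P1 ∘ pb1 P2) = f ∘ pb2 P2.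
    rewrite -em -!comp_assoc (comp_assoc q) -(pb_comm P1) -(pb_comm P2).
    by rewrite !comp_assoc euv.
  rewrite (pb_comm P1) (pb_comm P2) -comp_assoc.
  rewrite -(pb_lift1 P e) -[in RHS](pb_lift2 P e) !comp_assoc.
  by rewrite (proj1 Hq).
by exists (Build_Sub mm), q.
Qed.

Lemma regular_image_le {X Y : C} (f : X ~> Y) (I D : Sub Y) (h : X ~> sub_ob D) :
  is_regular_image f I -> f = sub_map D ∘ h -> sub_le I D.
Proof.
case=> e [re ef] eh; case: (re) => R [a [b [eab He]]].
have ehab : h ∘ a = h ∘ b.
  by apply: (@sub_mono _ D); rewrite !comp_assoc -eh ef -!comp_assoc eab.
case: (He _ h ehab) => u [eu _]; exists u.
by apply: (regular_epi_epi re); rewrite -ef eh -comp_assoc eu.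
Qed.

Definition regular_image {X Y : C} (f : X ~> Y) : Sub Y :=
  proj1_sig (constructive_indefinite_description _ (regular_image_exists f)).

Lemma regular_imageP {X Y : C} (f : X ~> Y) : is_regular_image f (regular_image f).
Proof. exact: proj2_sig (constructive_indefinite_description _ (regular_image_exists f)). Qed.

Lemma join_exists {X : C} (A B : Sub X) : exists J, is_join A B J.
Proof.
set f := copair (sub_map A) (sub_map B).
have If := regular_imageP f; case: (If) => e [_ ef].
exists (regular_image f); split; [|split].
- by exists (e ∘ in1 _); rewrite comp_assoc -ef copair1.
- by exists (e ∘ in2 _); rewrite comp_assoc -ef copair2.
- move=> D [a ea] [b eb]; apply: (regular_image_le (h := copair a b) If).
  by apply: copair_ext; rewrite -comp_assoc ?copair1 ?copair2.
Qed.

Definition join {X : C} (A B : Sub X) : Sub X :=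
  proj1_sig (constructive_indefinite_description _ (join_exists A B)).

Lemma joinP {X : C} (A B : Sub X) : is_join A B (join A B).
Proof. exact: proj2_sig (constructive_indefinite_description _ (join_exists A B)). Qed.

Definition commutator {X : C} (K L : Sub X) : Sub X :=
  regular_image (copair (sub_map K) (sub_map L) ∘ iota (sub_ob K) (sub_ob L)).

Definition commutator3 {X : C} (K L M : Sub X) : Sub X :=
  regular_image
    (copair (copair (sub_map K) (sub_map L)) (sub_map M)
     ∘ iota3 (sub_ob K) (sub_ob L) (sub_ob M)).

End SemiAbelian.

Arguments Sub {_} _.

(* Main.v *)
From Stdlib Require Import ssreflect ssrfun.
Require Import Defs.

(** The idea for groups. Let [N] be the join of the two iterated commutators; it is normal,
    so consider the images in the quotient [Q] by [N], where [[K,L]] commutes with [M], and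
    [[M,K]] with [L]. A word in [K], [L], [M] that vanishes in [K] is a product of
    conjugates [l^k] and [m^k]. In [Q] its value depends only on the word in [L] and [M]
    obtained by forgetting the [k], and on the separate products of the [l^k] and of the
    [m^k]: since [l^k = l [l,k]], where [[l,k]] commutes with [M] and with every [[m,k']],
    and symmetrically for [m^k], the three kinds of factors can be sorted. A ternary
    commutator word vanishes in each of [K + L], [K + M], [L + M], so all three data are
    trivial and its value is [1]. Hence [[K,L,M]] lies in [N].

    In a category, sorting means extending maps to a product of points: two maps on points
    over [Y] that agree on [Y] and commute on the kernels extend to the product of the
    points ([points_commute]). Coherence of the kernel functors enters there, and again in
    the decomposition of words: the kernel of [K + (L + M) -> K] is generated by the kernels
    of [K + L -> K] and [K + M -> K] ([flat_jse]). The argument above is then [ternary_le].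

    Normality of [N] follows from [normal_commutator] and [normal_join]. Both use
    coherence, through the criterion that a subobject is normal when conjugation restricts
    to it ([conj_closed_normal]); this is where exactness is used.

    The converse inclusions hold for arbitrary subobjects. The object [(K ◇ L) ◇ M] maps
    to the ternary cosmash product, and since commutators depend only on images
    ([comm_le_cover]) this gives [[[K,L],M] <= [K,L,M]]. The other iterated commutators
    follow, because the ternary cosmash product is symmetric: it is the part of
    [K + L + M] that vanishes in each of the three binary sums ([comm3_le_rot]). *)

Set Implicit Arguments.
Unset Strict Implicit.
Unset Printing Implicit Defensive.

Section ThreeSubobjects.
Context {C : SemiAbelianCategory}.

Local Notation "X × Y" := (prod_ob (product X Y)) (at level 40, left associativity).
Local Notation "X ⊕ Y" := (coprod_ob (coproduct X Y)) (at level 50, left associativity).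
Local Notation "X ◇ Y" := (cosmash X Y) (at level 40, left associativity).
Local Notation inl X Y := (in1 (coproduct X Y)).
Local Notation inr X Y := (in2 (coproduct X Y)).
Local Notation fst X Y := (pr1 (product X Y)).
Local Notation snd X Y := (pr2 (product X Y)).

(** * Computing with composites *)

Lemma from_zeroE {T Y : C} (f : T ~> zero_ob) : from_zero Y ∘ f = zero T Y.
Proof. by rewrite /zero; congr (_ ∘ _); exact: to_zero_eq. Qed.

Lemma copair1A {X Y T S : C} (a : X ~> T) (b : Y ~> T) (x : S ~> X) :
  copair a b ∘ (inl X Y ∘ x) = a ∘ x.
Proof. by rewrite comp_assoc copair1. Qed.

Lemma copair2A {X Y T S : C} (a : X ~> T) (b : Y ~> T) (x : S ~> Y) :
  copair a b ∘ (inr X Y ∘ x) = b ∘ x.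
Proof. by rewrite comp_assoc copair2. Qed.

Lemma pair1A {T X Y S : C} (a : T ~> X) (b : T ~> Y) (x : S ~> T) :
  fst X Y ∘ (pair a b ∘ x) = a ∘ x.
Proof. by rewrite comp_assoc pair1. Qed.

Lemma pair2A {T X Y S : C} (a : T ~> X) (b : T ~> Y) (x : S ~> T) :
  snd X Y ∘ (pair a b ∘ x) = b ∘ x.
Proof. by rewrite comp_assoc pair2. Qed.

Lemma pb_lift1A {X Y Z T S : C} {f : X ~> Z} {g : Y ~> Z} (P : Pullback f g)
    {a : T ~> X} {b : T ~> Y} (e : f ∘ a = g ∘ b) (x : S ~> T) :
  pb1 P ∘ (pb_lift P e ∘ x) = a ∘ x.
Proof. by rewrite comp_assoc pb_lift1. Qed.

Lemma pb_lift2A {X Y Z T S : C} {f : X ~> Z} {g : Y ~> Z} (P : Pullback f g)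
    {a : T ~> X} {b : T ~> Y} (e : f ∘ a = g ∘ b) (x : S ~> T) :
  pb2 P ∘ (pb_lift P e ∘ x) = b ∘ x.
Proof. by rewrite comp_assoc pb_lift2. Qed.

Lemma ker_liftA {X Y T S : C} (f : X ~> Y) {h : T ~> X} (e : f ∘ h = zero T Y)
    (x : S ~> T) : ker f ∘ (ker_lift e ∘ x) = h ∘ x.
Proof. by rewrite comp_assoc ker_liftP. Qed.

Lemma ker_zero {X Y : C} (f : X ~> Y) : f ∘ ker f = zero _ Y.
Proof. exact: proj1 (kerP f). Qed.

Lemma ker_zeroA {X Y S : C} (f : X ~> Y) (x : S ~> ker_ob f) :
  f ∘ (ker f ∘ x) = zero S Y.
Proof. by rewrite comp_assoc ker_zero zero_compl. Qed.

Lemma kernel_mono {K X Y : C} (f : X ~> Y) (k : K ~> X) : is_kernel f k -> mono k.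
Proof.
case=> k0 kU T u v e.
have h : f ∘ (k ∘ v) = zero T Y by rewrite comp_assoc k0 zero_compl.
exact: (unique_eq (kU T _ h)).
Qed.

Lemma ker_mono {X Y : C} (f : X ~> Y) : mono (ker f).
Proof. exact: kernel_mono (kerP f). Qed.

Lemma coprod_map1 {X Y X' Y' : C} (f : X ~> X') (g : Y ~> Y') :
  coprod_map f g ∘ inl X Y = inl X' Y' ∘ f.
Proof. exact: copair1. Qed.

Lemma coprod_map2 {X Y X' Y' : C} (f : X ~> X') (g : Y ~> Y') :
  coprod_map f g ∘ inr X Y = inr X' Y' ∘ g.
Proof. exact: copair2. Qed.

Lemma coprod_map1A {X Y X' Y' S : C} (f : X ~> X') (g : Y ~> Y') (x : S ~> X) :
  coprod_map f g ∘ (inl X Y ∘ x) = inl X' Y' ∘ (f ∘ x).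
Proof. by rewrite comp_assoc coprod_map1 -comp_assoc. Qed.

Lemma coprod_map2A {X Y X' Y' S : C} (f : X ~> X') (g : Y ~> Y') (x : S ~> Y) :
  coprod_map f g ∘ (inr X Y ∘ x) = inr X' Y' ∘ (g ∘ x).
Proof. by rewrite comp_assoc coprod_map2 -comp_assoc. Qed.

Lemma coprod_proj1_inl (X Y : C) : coprod_proj1 X Y ∘ inl X Y = 1_X.
Proof. exact: copair1. Qed.
Lemma coprod_proj1_inr (X Y : C) : coprod_proj1 X Y ∘ inr X Y = zero Y X.
Proof. exact: copair2. Qed.
Lemma coprod_proj2_inl (X Y : C) : coprod_proj2 X Y ∘ inl X Y = zero X Y.
Proof. exact: copair1. Qed.
Lemma coprod_proj2_inr (X Y : C) : coprod_proj2 X Y ∘ inr X Y = 1_Y.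
Proof. exact: copair2. Qed.

Lemma coprod_proj1_inlA (X Y S : C) (x : S ~> X) : coprod_proj1 X Y ∘ (inl X Y ∘ x) = x.
Proof. by rewrite comp_assoc coprod_proj1_inl comp_idl. Qed.
Lemma coprod_proj1_inrA (X Y S : C) (x : S ~> Y) :
  coprod_proj1 X Y ∘ (inr X Y ∘ x) = zero S X.
Proof. by rewrite comp_assoc coprod_proj1_inr zero_compl. Qed.
Lemma coprod_proj2_inlA (X Y S : C) (x : S ~> X) :
  coprod_proj2 X Y ∘ (inl X Y ∘ x) = zero S Y.
Proof. by rewrite comp_assoc coprod_proj2_inl zero_compl. Qed.
Lemma coprod_proj2_inrA (X Y S : C) (x : S ~> Y) : coprod_proj2 X Y ∘ (inr X Y ∘ x) = x.
Proof. by rewrite comp_assoc coprod_proj2_inr comp_idl. Qed.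

Lemma comp_assoc_rev {X Y Z W : C} (h : Z ~> W) (g : Y ~> Z) (f : X ~> Y) :
  (h ∘ g) ∘ f = h ∘ (g ∘ f).
Proof. by rewrite comp_assoc. Qed.

(* The zero laws come first: once they are exhausted, no composite contains [zero],
   which the associativity rule would otherwise unfold and split. *)
Definition compE :=
  ((@comp_idl C, @comp_idr C, @zero_compl C, @zero_compr C),
   (@copair1 C, @copair2 C, @pair1 C, @pair2 C, @copair1A, @copair2A, @pair1A, @pair2A),
   (@pb_lift1 C, @pb_lift2 C, @pb_lift1A, @pb_lift2A,
    @ker_liftP C, @ker_liftA, @ker_zero, @ker_zeroA),
   (@coprod_map1, @coprod_map2, @coprod_map1A, @coprod_map2A),
   (@coprod_proj1_inl, @coprod_proj1_inr, @coprod_proj2_inl, @coprod_proj2_inr,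
    @coprod_proj1_inlA, @coprod_proj1_inrA, @coprod_proj2_inlA, @coprod_proj2_inrA),
   @comp_assoc_rev).

Local Ltac cat := rewrite ?compE.

Lemma coprod_proj1_map {X Y X' Y' : C} (f : X ~> X') (g : Y ~> Y') :
  coprod_proj1 X' Y' ∘ coprod_map f g = f ∘ coprod_proj1 X Y.
Proof. by apply: copair_ext; cat. Qed.

Lemma coprod_proj2_map {X Y X' Y' : C} (f : X ~> X') (g : Y ~> Y') :
  coprod_proj2 X' Y' ∘ coprod_map f g = g ∘ coprod_proj2 X Y.
Proof. by apply: copair_ext; cat. Qed.

(** * Monomorphisms, covers and jointly strongly epic pairs *)

(** For a monomorphism [m] this says that the generalized element [f] lies in the
    subobject [m]; inclusions between subobjects are proved in this form. *)
Definition factors {X Y Z : C} (m : Y ~> Z) (f : X ~> Z) : Prop := exists h, f = m ∘ h.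

(** Extremal epimorphisms. They are the same as regular epimorphisms
    ([regular_epi_cover], [cover_regular_epi]), but being one is tested on subobjects
    only, which makes closure under sums and composites immediate. *)
Definition cover {X Y : C} (e : X ~> Y) : Prop :=
  forall W (m : W ~> Y), mono m -> factors m e -> iso m.

Lemma factors_comp {W X Y Z : C} (m : Y ~> Z) (f : X ~> Z) (g : W ~> X) :
  factors m f -> factors m (f ∘ g).
Proof. by case=> h ->; exists (h ∘ g); rewrite comp_assoc. Qed.

Lemma iso_factors {X Y Z : C} (m : Y ~> Z) (f : X ~> Z) : iso m -> factors m f.
Proof. by case=> g [_ gm]; exists (g ∘ f); rewrite comp_assoc gm comp_idl. Qed.

Lemma split_mono_iso {X Y : C} (m : X ~> Y) : mono m -> factors m (1_Y) -> iso m.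
Proof.
move=> mm [g eg]; exists g; split=> //.
by apply: mm; rewrite comp_assoc -eg comp_idl comp_idr.
Qed.

Lemma jse_factors {X Y Z W T : C} (f : X ~> Z) (g : Y ~> Z) (m : W ~> Z) (h : T ~> Z) :
  jointly_strongly_epic f g -> mono m -> factors m f -> factors m g -> factors m h.
Proof. by move=> j mm ff fg; apply: iso_factors; apply: j. Qed.

Lemma cover_factors_all {X Z W T : C} (f : X ~> Z) (m : W ~> Z) (h : T ~> Z) :
  cover f -> mono m -> factors m f -> factors m h.
Proof. by move=> j mm ff; apply: iso_factors; apply: j. Qed.

(** The pullback of the graphs of [u] and [v]. *)
Lemma equalizer_exists {X T : C} (u v : X ~> T) :
  exists (E : C) (e : E ~> X), mono e /\ u ∘ e = v ∘ e /\
    forall S (h : S ~> X), u ∘ h = v ∘ h -> factors e h.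
Proof.
case: (sa_pullbacks (pair (1_X) u) (pair (1_X) v)) => P.
have c := pb_comm P.
have e1 : pb1 P = pb2 P.
  by [have := f_equal (fun z => fst X T ∘ z) c; cat].
have e2 : u ∘ pb1 P = v ∘ pb1 P.
  by [have := f_equal (fun z => snd X T ∘ z) c; cat; rewrite -e1].
exists (pb_ob P), (pb1 P); split; [|split] => //.
  by move=> S a b eab; apply: pb_ext; rewrite -?e1.
move=> S h eh.
have ep : pair (1_X) u ∘ h = pair (1_X) v ∘ h by [apply: pair_ext; cat].
by exists (pb_lift P ep); rewrite pb_lift1.
Qed.

(** The equalizer of [u] and [v] is a subobject through which [f] and [g] factor. *)
Lemma jse_epi {X Y Z T : C} (f : X ~> Z) (g : Y ~> Z) (u v : Z ~> T) :
  jointly_strongly_epic f g -> u ∘ f = v ∘ f -> u ∘ g = v ∘ g -> u = v.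
Proof.
move=> j ef eg; case: (equalizer_exists u v) => E [e [me [ee eU]]].
case: (jse_factors (1_Z) j me (eU _ _ ef) (eU _ _ eg)) => s es.
by rewrite -(comp_idr u) -(comp_idr v) es !comp_assoc ee.
Qed.

Lemma mono_comp {X Y Z : C} (f : Y ~> Z) (g : X ~> Y) : mono f -> mono g -> mono (f ∘ g).
Proof. by move=> mf mg T u v; rewrite -!comp_assoc => e; apply: mg; apply: mf. Qed.

Lemma pb_mono2 {X Y Z : C} (m : X ~> Z) (g : Y ~> Z) (P : Pullback m g) :
  mono m -> mono (pb2 P).
Proof.
move=> mm T u v e; apply: pb_ext => //; apply: mm.
by rewrite !comp_assoc pb_comm -!comp_assoc e.
Qed.

Lemma preimage {W Z Y : C} (m : W ~> Z) (g : Y ~> Z) : mono m ->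
  exists (P : C) (n : P ~> Y), mono n /\
    forall T (h : T ~> Y), factors n h <-> factors m (g ∘ h).
Proof.
move=> mm; case: (sa_pullbacks m g) => P.
exists (pb_ob P), (pb2 P); split; first exact: pb_mono2.
move=> T h; split.
- by case=> u ->; exists (pb1 P ∘ u); rewrite !comp_assoc pb_comm.
- by case=> u /esym e; exists (pb_lift P e); rewrite pb_lift2.
Qed.

Lemma jse_local {X Y Z Z' W : C} (f : X ~> Z) (g : Y ~> Z) (u : Z ~> Z') (m : W ~> Z') :
  jointly_strongly_epic f g -> mono m -> factors m (u ∘ f) -> factors m (u ∘ g) -> factors m u.
Proof.
move=> j mm ff fg; case: (preimage u mm) => P [n [mn nP]].
rewrite -(comp_idr u); apply/nP.
by apply: (jse_factors _ j mn); apply/nP.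
Qed.

Lemma cover_local {X Z Z' W : C} (f : X ~> Z) (u : Z ~> Z') (m : W ~> Z') :
  cover f -> mono m -> factors m (u ∘ f) -> factors m u.
Proof.
move=> j mm ff; case: (preimage u mm) => P [n [mn nP]].
rewrite -(comp_idr u); apply/nP.
by apply: (cover_factors_all _ j mn); apply/nP.
Qed.

Lemma coprod_jse (X Y : C) : jointly_strongly_epic (inl X Y) (inr X Y).
Proof.
move=> W m mm [a ea] [b eb]; apply: split_mono_iso => //.
by [exists (copair a b); apply: copair_ext; cat].
Qed.

Lemma jse_copair {X Y Z : C} (f : X ~> Z) (g : Y ~> Z) :
  jointly_strongly_epic f g -> cover (copair f g).
Proof.
move=> j W m mm [h eh]; apply: j => //.
- by exists (h ∘ inl X Y); rewrite comp_assoc -eh copair1.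
- by exists (h ∘ inr X Y); rewrite comp_assoc -eh copair2.
Qed.

Lemma copair_jse {X Y Z : C} (f : X ~> Z) (g : Y ~> Z) :
  cover (copair f g) -> jointly_strongly_epic f g.
Proof.
move=> j W m mm [a ea] [b eb]; apply: j => //.
by [exists (copair a b); apply: copair_ext; cat].
Qed.

Lemma cover_mono_iso {X Y : C} (f : X ~> Y) : cover f -> mono f -> iso f.
Proof. by move=> cf mf; apply: cf => //; exists (1_X); rewrite comp_idr. Qed.

Lemma regular_epi_cover {X Y : C} (e : X ~> Y) : regular_epi e -> cover e.
Proof.
case=> R [a [b [eab eU]]] W m mm [h eh]; apply: split_mono_iso => //.
have hab : h ∘ a = h ∘ b by apply: mm; rewrite !comp_assoc -eh.
case: (eU _ h hab) => u [ue _]; exists u.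
have e1 : e ∘ a = e ∘ b by [].
by apply: (unique_eq (eU _ _ e1)); rewrite ?comp_idl // -comp_assoc ue -eh.
Qed.

Lemma image_exists {X Y : C} (f : X ~> Y) :
  exists (I : C) (m : I ~> Y) (e : X ~> I), mono m /\ cover e /\ f = m ∘ e.
Proof.
case: (regular_image_exists f) => I [e [re ef]].
exists (sub_ob I), (sub_map I), e; split; [exact: sub_mono | split=> //].
exact: regular_epi_cover.
Qed.

Lemma cover_regular_epi {X Y : C} (e : X ~> Y) : cover e -> regular_epi e.
Proof.
move=> ce; case: (regular_image_exists e) => I [q [[R [a [b [qab qU]]]] eq]].
have [g [gm mg]] : iso (sub_map I) by apply: ce; [exact: sub_mono | exists q].
exists R, a, b; split; first by rewrite eq -!comp_assoc qab.
move=> T h hab; case: (qU T h hab) => u [uq uU].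
exists (u ∘ g); split.
  by rewrite eq -comp_assoc (comp_assoc g) gm comp_idl.
move=> v ev; have -> : u = v ∘ sub_map I by apply: uU; rewrite -comp_assoc -eq.
by rewrite -comp_assoc mg comp_idr.
Qed.

(** Stability of covers under pullback, in the form that permits element-style
    reasoning: a generalized element of the target lifts after a change of stage [c].
    With [cover_local], membership in a subobject may be checked after such a change. *)
Lemma cover_lift {X Y T : C} (e : X ~> Y) (t : T ~> Y) : cover e ->
  exists (T' : C) (c : T' ~> T) (t' : T' ~> X), cover c /\ e ∘ t' = t ∘ c.
Proof.
move=> /cover_regular_epi ce; case: (sa_pullbacks t e) => P.
exists (pb_ob P), (pb1 P), (pb2 P); split; last by rewrite pb_comm.
apply: regular_epi_cover.
exact: (proj2 (proj2 (proj1 (sa_exact C))) _ _ _ _ _ _ _ _ (pbP P) ce).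
Qed.

Lemma cover_of_comp {X Y Z : C} (f : Y ~> Z) (g : X ~> Y) : cover (f ∘ g) -> cover f.
Proof.
move=> c W m mm [h eh]; apply: c => //.
by exists (h ∘ g); rewrite comp_assoc -eh.
Qed.

Lemma coprod_map_cover {X X' Y Y' : C} (f : X ~> X') (g : Y ~> Y') :
  cover f -> cover g -> cover (coprod_map f g).
Proof.
move=> cf cg W m mm fm.
apply: (coprod_jse (X := X') (Y := Y')) => //.
- apply: (cover_local cf mm); rewrite -(coprod_map1 f g); exact: factors_comp.
- apply: (cover_local cg mm); rewrite -(coprod_map2 f g); exact: factors_comp.
Qed.

Lemma cover_id (X : C) : cover (1_X).
Proof. by move=> W m mm fm; apply: split_mono_iso. Qed.

(** * Consequences of protomodularity *)

Lemma kernel_lift {K X Y T : C} (f : X ~> Y) (k : K ~> X) (t : T ~> X) :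
  is_kernel f k -> f ∘ t = zero T Y -> factors k t.
Proof. by case=> _ kU e; case: (kU T t e) => u [<- _]; exists u. Qed.

(** This is how protomodularity is used: a subobject of [X] containing both the
    kernel and the section is a subpoint whose inclusion becomes invertible after
    pulling back along [0 -> Y], hence is invertible. *)
Lemma point_jse {K X Y : C} (p : X ~> Y) (s : Y ~> X) (k : K ~> X) :
  p ∘ s = 1_Y -> is_kernel p k -> jointly_strongly_epic k s.
Proof.
move=> ps kp W m mm [k' ek] [s' es].
case: (sa_protomodular C) => H /(_ _ _ (from_zero Y)) refl.
have ps' : (p ∘ m) ∘ s' = 1_Y by rewrite -comp_assoc -es.
pose A : Pt Y := Build_Point ps.
pose B : Pt Y := Build_Point ps'.
have mp : pt_proj A ∘ m = pt_proj B by [].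
have ms : m ∘ pt_sec B = pt_sec A by rewrite /= -es.
pose M : B ~> A := @Build_PointHom C Y B A m mp ms.
suff : iso (fmap (change_of_base H (from_zero Y)) M).
  move=> /refl [g [gM Mg]]; exists (pt_map g); split.
    exact: (f_equal (fun h => pt_map h) gM).
  exact: (f_equal (fun h => pt_map h) Mg).
set PA := cob_pb H (from_zero Y) A; set PB := cob_pb H (from_zero Y) B.
have eA := pb_comm PA; rewrite /= in eA.
have k0 : p ∘ pb2 PA = zero _ Y.
  by rewrite -eA from_zeroE.
case: (kernel_lift kp k0) => u eu.
have c : from_zero Y ∘ pb1 PA = pt_proj B ∘ (k' ∘ u).
  by rewrite eA eu ek /= -!comp_assoc.
pose g := pb_lift PB c.
have fg : pt_map (fmap (change_of_base H (from_zero Y)) M) ∘ g = 1_(pb_ob PA).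
  by apply: pb_ext; rewrite /=; cat => //; rewrite eu ek -comp_assoc.
have gf : g ∘ pt_map (fmap (change_of_base H (from_zero Y)) M) = 1_(pb_ob PB).
  apply: pb_ext; rewrite /=; cat => //; apply: mm.
  by [rewrite !comp_assoc -ek -eu; cat].
have gp : pt_proj (cob_ob H (from_zero Y) B) ∘ g = pt_proj (cob_ob H (from_zero Y) A).
  by [rewrite /=; cat].
have gs : g ∘ pt_sec (cob_ob H (from_zero Y) A) = pt_sec (cob_ob H (from_zero Y) B).
  have := pt_map_sec (fmap (change_of_base H (from_zero Y)) M) => /= <-.
  by rewrite comp_assoc; rewrite /= in gf; rewrite gf comp_idl.
exists (@Build_PointHom C _ (cob_ob H (from_zero Y) A) (cob_ob H (from_zero Y) B) g gp gs);
 split; apply: PointHom_eq; [exact: gf | exact: fg].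
Qed.

(** The first projection of the kernel pair is split by the diagonal and its kernel
    vanishes, so the two projections agree as soon as they agree on the diagonal. *)
Lemma zero_kernel_mono {X Y : C} (f : X ~> Y) :
  (forall T (t : T ~> X), f ∘ t = zero T Y -> t = zero T X) -> mono f.
Proof.
move=> f0 T u v e; case: (sa_pullbacks f f) => P.
have ed : f ∘ 1_X = f ∘ 1_X by [].
have ps : pb1 P ∘ pb_lift P ed = 1_X by rewrite pb_lift1.
have j := point_jse ps (kerP (pb1 P)).
have e12 : pb1 P = pb2 P.
  apply: (jse_epi j); last by cat.
  rewrite ker_zero; apply/esym/f0.
  by [rewrite comp_assoc -pb_comm; cat].
by rewrite -(pb_lift1 P e) -[RHS](pb_lift2 P e) e12.
Qed.

(** A map [g] killing the kernel of [f] coequalizes the kernel pair of [f]: by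
    [point_jse], this may be tested on the diagonal and on the elements [(0, x)] with
    [x] in the kernel. *)
Lemma cover_cokernel {X Y T : C} (f : X ~> Y) (g : X ~> T) :
  cover f -> g ∘ ker f = zero _ T -> exists h, g = h ∘ f.
Proof.
move=> /cover_regular_epi [R [a [b [fab fU]]]] g0.
suff gab : g ∘ a = g ∘ b by case: (fU _ _ gab) => h [<- _]; exists h.
case: (sa_pullbacks f f) => P.
have ed : f ∘ 1_X = f ∘ 1_X by [].
have ps : pb1 P ∘ pb_lift P ed = 1_X by rewrite pb_lift1.
have j := point_jse ps (kerP (pb1 P)).
have e12 : g ∘ pb1 P = g ∘ pb2 P.
  apply: (jse_epi j); last by cat.
  have z : f ∘ (pb2 P ∘ ker (pb1 P)) = zero _ Y.
    by [rewrite comp_assoc -pb_comm; cat].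
  by [cat; rewrite -(ker_liftP z) comp_assoc g0; cat].
by rewrite -(pb_lift1 P fab) -[in RHS](pb_lift2 P fab) !comp_assoc e12.
Qed.

(** The kernel of [q] is contained in the image of [i], so that [point_jse] applies to
    the point [(q, j)]. *)
Lemma pullback_jse {A B Y P : C} (pA : A ~> Y) (sA : Y ~> A) (pB : B ~> Y) (sB : Y ~> B)
    (p : P ~> A) (q : P ~> B) (i : A ~> P) (j : B ~> P) :
  pA ∘ sA = 1_Y -> is_pullback pA pB p q ->
  p ∘ i = 1_A -> q ∘ i = sB ∘ pA -> p ∘ j = sA ∘ pB -> q ∘ j = 1_B ->
  jointly_strongly_epic i j.
Proof.
move=> esA PP pi qi pj qj W m mm fi fj.
apply: (point_jse qj (kerP q)) => //.
suff -> : ker q = i ∘ (p ∘ ker q) by exact: factors_comp.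
have U := proj2 PP _ (p ∘ ker q) (zero _ B).
have e : pA ∘ (p ∘ ker q) = pB ∘ zero _ B.
  by rewrite comp_assoc (proj1 PP) -comp_assoc ker_zero.
apply: (unique_eq (U e)); first by rewrite ker_zero.
split; first by rewrite !comp_assoc pi comp_idl.
by [rewrite !comp_assoc qi -!comp_assoc e; cat].
Qed.

Lemma prod_jse (A B : C) :
  jointly_strongly_epic (pair (1_A) (zero A B)) (pair (zero B A) (1_B)).
Proof.
apply: (pullback_jse (Y := zero_ob) (pA := to_zero A) (pB := to_zero B)
   (sA := from_zero A) (sB := from_zero B) (p := fst A B) (q := snd A B)).
- exact: to_zero_eq.
- split; first exact: to_zero_eq.
  move=> T a b _; exact: prodP.
- by cat.
- by cat.
- by cat.
- by cat.
Qed.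

(** The Mal'tsev property. The triples [(u, v, w)] of elements of the relation with
    [u], [v] sharing one coordinate and [v], [w] the other form a product of two points
    over the object of the [v]; those for which the conclusion holds contain the triples
    [(u, v, v)] and [(v, v, w)], hence are all of them by [pullback_jse]. *)
Lemma difunctional {R X Y T : C} (r : R ~> X) (r' : R ~> Y) (u v w : T ~> R) :
  mono (pair r r') -> r' ∘ u = r' ∘ v -> r ∘ v = r ∘ w ->
  exists z : T ~> R, r ∘ z = r ∘ u /\ r' ∘ z = r' ∘ w.
Proof.
move=> mr euv evw.
case: (sa_pullbacks r' r') => E2; case: (sa_pullbacks r r) => E1.
case: (sa_pullbacks (pb2 E2) (pb1 E1)) => P.
have e2 : r' ∘ 1_R = r' ∘ 1_R by [].
have e1 : r ∘ 1_R = r ∘ 1_R by [].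
have s2 : pb2 E2 ∘ pb_lift E2 e2 = 1_R by cat.
have ei : pb2 E2 ∘ 1_(pb_ob E2) = pb1 E1 ∘ (pb_lift E1 e1 ∘ pb2 E2) by cat.
have ej : pb2 E2 ∘ (pb_lift E2 e2 ∘ pb1 E1) = pb1 E1 ∘ 1_(pb_ob E1) by cat.
have j : jointly_strongly_epic (pb_lift P ei) (pb_lift P ej).
  by [apply: (pullback_jse s2 (pbP P)); cat].
case: (preimage (pair (r ∘ pb1 E2 ∘ pb1 P) (r' ∘ pb2 E1 ∘ pb2 P)) mr) => Q [n [mn nP]].
have e : pb2 E2 ∘ pb_lift E2 euv = pb1 E1 ∘ pb_lift E1 evw by cat.
have : factors n (pb_lift P e).
  apply: (jse_factors _ j mn); apply/nP.
    by [exists (pb1 E2); apply: pair_ext; cat; rewrite ?pb_comm].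
  by [exists (pb2 E1); apply: pair_ext; cat; rewrite ?pb_comm].
move=> /nP [z ez]; exists z; split.
- by [have := f_equal (fun h => fst X Y ∘ h) ez; cat].
- by [have := f_equal (fun h => snd X Y ∘ h) ez; cat].
Qed.

(** * Coherence of the kernel functors *)

(** The kernel pair of a morphism of points is again a point. *)
Lemma point_mono {Y : C} {W Z : Pt Y} (m : W ~> Z) : mono m -> mono (pt_map m).
Proof.
move=> mm; case: (sa_pullbacks (pt_map m) (pt_map m)) => P.
have c : pt_map m ∘ pt_sec W = pt_map m ∘ pt_sec W by [].
have sp : (pt_proj W ∘ pb1 P) ∘ pb_lift P c = 1_Y by cat; exact: pt_split.
pose R : Pt Y := Build_Point sp.
have p1 : pt_proj W ∘ pb1 P = pt_proj R by [].
have s1 : pb1 P ∘ pt_sec R = pt_sec W by [rewrite /=; cat].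
have p2 : pt_proj W ∘ pb2 P = pt_proj R.
  by rewrite /= -(pt_map_proj m) -!comp_assoc pb_comm.
have s2 : pb2 P ∘ pt_sec R = pt_sec W by [rewrite /=; cat].
pose a : R ~> W := @Build_PointHom C Y R W _ p1 s1.
pose b : R ~> W := @Build_PointHom C Y R W _ p2 s2.
have ab : a = b by apply: mm; apply: PointHom_eq; exact: pb_comm.
have e12 : pb1 P = pb2 P := f_equal (fun h => pt_map h) ab.
by move=> T u v e; rewrite -(pb_lift1 P e) -[RHS](pb_lift2 P e) e12.
Qed.

Lemma point_hom_jse {Y : C} {A B Z : Pt Y} (f : A ~> Z) (g : B ~> Z) :
  jointly_strongly_epic (pt_map f) (pt_map g) -> jointly_strongly_epic f g.
Proof.
move=> j W m /point_mono mm [f' ef] [g' eg].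
have [h [hm mh]] : iso (pt_map m).
  apply: j => //.
    by exists (pt_map f'); rewrite ef.
  by exists (pt_map g'); rewrite eg.
have hp : pt_proj W ∘ h = pt_proj Z by rewrite -(pt_map_proj m) -comp_assoc mh comp_idr.
have hs : h ∘ pt_sec Z = pt_sec W by rewrite -(pt_map_sec m) comp_assoc hm comp_idl.
by exists (Build_PointHom hp hs); split; apply: PointHom_eq.
Qed.

Section Coherent.
Hypothesis HC : algebraically_coherent C.

(** Coherence of change of base along [0 -> Y], stated for arbitrary choices of
    the induced maps between kernels. This is the only instance of algebraic coherence
    that the proof uses. *)
Lemma kernel_jse {Y : C} {A B Z : Pt Y} (f : A ~> Z) (g : B ~> Z)
    (f' : ker_ob (pt_proj A) ~> ker_ob (pt_proj Z))
    (g' : ker_ob (pt_proj B) ~> ker_ob (pt_proj Z)) :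
  jointly_strongly_epic (pt_map f) (pt_map g) ->
  ker (pt_proj Z) ∘ f' = pt_map f ∘ ker (pt_proj A) ->
  ker (pt_proj Z) ∘ g' = pt_map g ∘ ker (pt_proj B) ->
  jointly_strongly_epic f' g'.
Proof.
move=> /point_hom_jse j ef eg W m mm [hf mf] [hg mg].
case: HC => HL /(_ _ _ (from_zero Y)) [_ /(_ _ _ _ _ _ j)].
set H := has_pullbacks_split_epi _ => J.
have pk (D : Pt Y) : exists u : pb_ob (cob_pb H (from_zero Y) D) ~> ker_ob (pt_proj D),
    pb2 (cob_pb H (from_zero Y) D) = ker (pt_proj D) ∘ u.
  apply: (kernel_lift (kerP _)).
  by rewrite -pb_comm from_zeroE.
have lp (D : Pt Y) T (t : T ~> pt_ob D) : pt_proj D ∘ t = zero T Y ->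
    from_zero Y ∘ to_zero T = pt_proj D ∘ t by rewrite from_zeroE.
have zm : pt_proj Z ∘ (ker (pt_proj Z) ∘ m) = zero W Y by cat.
have sW : to_zero W ∘ from_zero W = 1_zero_ob by exact: to_zero_eq.
pose PW : Pt zero_ob := Build_Point sW.
pose m0 := pb_lift (cob_pb H (from_zero Y) Z) (lp Z _ _ zm).
have m0p : pt_proj (cob_ob H (from_zero Y) Z) ∘ m0 = pt_proj PW by exact: to_zero_eq.
have m0s : m0 ∘ pt_sec PW = pt_sec (cob_ob H (from_zero Y) Z) by exact: from_zero_eq.
pose M : PW ~> cob_ob H (from_zero Y) Z :=
  @Build_PointHom C _ PW (cob_ob H (from_zero Y) Z) m0 m0p m0s.
have m0mono : mono m0.
  move=> T u v e; apply: mm; apply: (ker_mono (f := pt_proj Z)).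
  have := f_equal (fun h => pb2 (cob_pb H (from_zero Y) Z) ∘ h) e.
  by [rewrite /m0; cat].
have lift (D : Pt Y) (h : D ~> Z) (h' : ker_ob (pt_proj D) ~> W) :
    ker (pt_proj Z) ∘ (m ∘ h') = pt_map h ∘ ker (pt_proj D) ->
    exists x, fmap (change_of_base H (from_zero Y)) h = M ∘ x.
  move=> eh; case: (pk D) => u eu.
  have xp : pt_proj PW ∘ (h' ∘ u) = pt_proj (cob_ob H (from_zero Y) D) by exact: to_zero_eq.
  have xs : (h' ∘ u) ∘ pt_sec (cob_ob H (from_zero Y) D) = pt_sec PW
    by exact: from_zero_eq.
  exists (@Build_PointHom C _ (cob_ob H (from_zero Y) D) PW _ xp xs).
  apply: PointHom_eq; apply: (pb_ext (P := cob_pb H (from_zero Y) Z)).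
    exact: to_zero_eq.
  rewrite /= /m0; cat; rewrite eu !comp_assoc -eh; cat.
  by [].
have [] : iso M.
  apply: J.
      move=> T u v e; apply: PointHom_eq; apply: m0mono.
      exact: (f_equal (fun h => pt_map h) e).
    by apply: (lift A f hf); rewrite -mf.
  by apply: (lift B g hg); rewrite -mg.
move=> G [_ /(f_equal (fun h => pt_map h)) /= MG].
apply: split_mono_iso => //.
have zk : pt_proj Z ∘ ker (pt_proj Z) = zero _ Y by cat.
have [z ez] : exists z, pb2 (cob_pb H (from_zero Y) Z) ∘ z = ker (pt_proj Z).
  by exists (pb_lift (cob_pb H (from_zero Y) Z) (lp Z _ _ zk)); rewrite pb_lift2.
exists (pt_map G ∘ z).
apply: (ker_mono (f := pt_proj Z)).
have := f_equal (fun h => pb2 (cob_pb H (from_zero Y) Z) ∘ (h ∘ z)) MG.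
by rewrite /m0; cat; rewrite ez => e; rewrite e.
Qed.

(** The object usually written [X ♭ A], which in the case of groups is the
    normal closure of [A] in the free product of [X] and [A]. *)
Definition flat (X A : C) : C := ker_ob (coprod_proj1 X A).
Definition flat_in (X A : C) : flat X A ~> X ⊕ A := ker (coprod_proj1 X A).

Lemma flat_map_comm {X A B : C} (f : A ~> B) :
  coprod_proj1 X B ∘ (coprod_map (1_X) f ∘ flat_in X A) = zero (flat X A) X.
Proof. by rewrite comp_assoc coprod_proj1_map; cat. Qed.

Definition flat_map (X : C) {A B : C} (f : A ~> B) : flat X A ~> flat X B :=
  ker_lift (flat_map_comm f).

Lemma flat_mapE (X : C) {A B : C} (f : A ~> B) :
  flat_in X B ∘ flat_map X f = coprod_map (1_X) f ∘ flat_in X A.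
Proof. exact: ker_liftP. Qed.

Definition coprod_point (X A : C) : Pt X := Build_Point (coprod_proj1_inl X A).

Lemma coprod_point_map_proj (X : C) {A B : C} (f : A ~> B) :
  pt_proj (coprod_point X B) ∘ coprod_map (1_X) f = pt_proj (coprod_point X A).
Proof. by rewrite /= coprod_proj1_map; cat. Qed.

Lemma coprod_point_map_sec (X : C) {A B : C} (f : A ~> B) :
  coprod_map (1_X) f ∘ pt_sec (coprod_point X A) = pt_sec (coprod_point X B).
Proof. by rewrite /=; cat. Qed.

Definition coprod_point_map (X : C) {A B : C} (f : A ~> B) :
  coprod_point X A ~> coprod_point X B :=
  @Build_PointHom C X (coprod_point X A) (coprod_point X B) _
    (coprod_point_map_proj X f) (coprod_point_map_sec X f).

(** For groups: words on conjugates of elements of [A] and [B] are products of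
    conjugates of elements of [A] and conjugates of elements of [B]. *)
Lemma flat_jse (X A B : C) :
  jointly_strongly_epic (flat_map X (inl A B)) (flat_map X (inr A B)).
Proof.
apply: (kernel_jse (f := coprod_point_map X (inl A B)) (g := coprod_point_map X (inr A B))).
- move=> W m mm /= [f ef] [g eg]; apply: split_mono_iso => //.
  exists (copair (f ∘ inl X A) (copair (f ∘ inr X A) (g ∘ inr X B))).
  have e1 := f_equal (fun h => h ∘ inl X A) ef.
  have e2 := f_equal (fun h => h ∘ inr X A) ef.
  have e3 := f_equal (fun h => h ∘ inr X B) eg.
  move: e1 e2 e3; cat => e1 e2 e3.
  apply: copair_ext; cat => //.
  by [apply: copair_ext; cat].
- exact: flat_mapE.
- exact: flat_mapE.
Qed.

(** * Normality and conjugation *)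

(** The conjugation action of [X] on itself restricts to [H]. *)
Definition conj_closed {H X : C} (h : H ~> X) : Prop :=
  forall T (t : T ~> X ⊕ H), coprod_proj1 X H ∘ t = zero T X -> factors h (copair (1_X) h ∘ t).

(** Modulo a normal [M], a word in [A] and [M] equals its [A]-part. *)
Lemma normal_absorbs {X : C} (M : Sub X) : normal M ->
  forall A (f : A ~> X) T (t : T ~> A ⊕ sub_ob M),
    coprod_proj1 A (sub_ob M) ∘ t = zero T A -> factors (sub_map M) (copair f (sub_map M) ∘ t).
Proof.
case=> Y [v kv] A f T t t0; apply: (kernel_lift kv).
have -> : v ∘ (copair f (sub_map M) ∘ t) = (v ∘ f) ∘ (coprod_proj1 A (sub_ob M) ∘ t).
  rewrite !comp_assoc; congr (_ ∘ _); apply: copair_ext; cat => //.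
  by rewrite (proj1 kv).
by [rewrite t0; cat].
Qed.

Lemma normal_absorbs_r {X : C} (M : Sub X) : normal M ->
  forall A (f : A ~> X) T (t : T ~> sub_ob M ⊕ A),
    coprod_proj2 (sub_ob M) A ∘ t = zero T A -> factors (sub_map M) (copair (sub_map M) f ∘ t).
Proof.
case=> Y [v kv] A f T t t0; apply: (kernel_lift kv).
have -> : v ∘ (copair (sub_map M) f ∘ t) = (v ∘ f) ∘ (coprod_proj2 (sub_ob M) A ∘ t).
  rewrite !comp_assoc; congr (_ ∘ _); apply: copair_ext; cat => //.
  by rewrite (proj1 kv).
by [rewrite t0; cat].
Qed.

(** The elements [(x, x h)] form a reflexive relation, which by difunctionality is
    an equivalence relation, hence by exactness a kernel pair of some [f]. The kernel of
    [f] consists of the [t] with [(0, t)] in the relation; these come from words in [X]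
    and [H] that vanish in [X], and closure under conjugation puts them in [H]. *)
Lemma conj_closed_normal {X : C} (H : Sub X) : conj_closed (sub_map H) -> normal H.
Proof.
set h := sub_map H => Hh; set A := sub_ob H.
case: (image_exists (pair (coprod_proj1 X A) (copair (1_X) h))) => R [m [e [mm [ce em]]]].
pose r1 := fst X X ∘ m; pose r2 := snd X X ∘ m.
have r1e : r1 ∘ e = coprod_proj1 X A by [rewrite /r1 -comp_assoc -em; cat].
have r2e : r2 ∘ e = copair (1_X) h by [rewrite /r2 -comp_assoc -em; cat].
have mr : mono (pair r1 r2).
  move=> T u v euv; apply: mm; apply: pair_ext.
    by [have := f_equal (fun z => fst X X ∘ z) euv; rewrite /r1; cat].
  by [have := f_equal (fun z => snd X X ∘ z) euv; rewrite /r2; cat].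
pose d := e ∘ inl X A.
have r1d : r1 ∘ d = 1_X by [rewrite /d comp_assoc r1e; cat].
have r2d : r2 ∘ d = 1_X by [rewrite /d comp_assoc r2e; cat].
have er : equivalence_relation r1 r2.
{ split; [|split; [|split]].
  - by move=> T u v e1 e2; apply: mr; apply: pair_ext; rewrite !comp_assoc ?pair1 ?pair2.
  - by exists d.
  - case: (@difunctional _ _ _ _ r1 r2 (d ∘ r2) (1_R) (d ∘ r1) mr).
        by [rewrite comp_assoc r2d; cat].
      by [rewrite comp_assoc r1d; cat].
    move=> s [s1 s2]; exists s; split.
      by rewrite s1 comp_assoc r1d comp_idl.
    by rewrite s2 comp_assoc r2d comp_idl.
  - move=> P p q [pq _].
    case: (@difunctional _ _ _ _ r1 r2 p (d ∘ (r2 ∘ p)) q mr).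
        by [rewrite comp_assoc r2d; cat].
      by rewrite comp_assoc r1d comp_idl.
    by move=> t Ht; exists t. }
case: (proj2 (sa_exact C) _ _ _ _ er) => Y [f fR].
exists Y, f; split.
- have h0 : r1 ∘ (e ∘ inr X A) = zero A X by [rewrite comp_assoc r1e; cat].
  have hh : r2 ∘ (e ∘ inr X A) = h by [rewrite comp_assoc r2e; cat].
  by rewrite -/h -hh (comp_assoc f) -(proj1 fR) -(comp_assoc f) h0 zero_compr.
- move=> T t ft.
  have e0 : f ∘ zero T X = f ∘ t by [rewrite ft; cat].
  case: (proj2 fR _ _ _ e0) => u [[u1 u2] _].
  suff [v ev] : factors h t.
    exists v; split => // w ew; apply: (@sub_mono _ _ H).
    by rewrite -/h ew.
  case: (cover_lift u ce) => T' [c [t' [cc et']]].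
  apply: (cover_local cc (@sub_mono _ _ H)).
  rewrite -u2 -comp_assoc -et' comp_assoc r2e.
  apply: Hh; rewrite -r1e -comp_assoc et' comp_assoc u1; cat.
  by [].
Qed.

(** * Commutators of maps *)

(** [comm_le f g D] says that the commutator of the images of [f] and [g] lies in [D],
    expressed by elements so that composing, swapping and restricting [f] and [g] are
    direct. *)
Definition comm_le {A B X : C} (f : A ~> X) (g : B ~> X) (D : Sub X) : Prop :=
  forall T (t : T ~> A ⊕ B), coprod_proj1 A B ∘ t = zero T A ->
    coprod_proj2 A B ∘ t = zero T B -> factors (sub_map D) (copair f g ∘ t).

Lemma iota_proj1 (A B : C) : coprod_proj1 A B ∘ iota A B = zero (A ◇ B) A.
Proof.
have := f_equal (fun z => fst A B ∘ z) (ker_zero (coprod_to_prod A B)).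
by [rewrite /coprod_to_prod; cat].
Qed.

Lemma iota_proj2 (A B : C) : coprod_proj2 A B ∘ iota A B = zero (A ◇ B) B.
Proof.
have := f_equal (fun z => snd A B ∘ z) (ker_zero (coprod_to_prod A B)).
by [rewrite /coprod_to_prod; cat].
Qed.

Lemma iota_factors {A B T : C} (t : T ~> A ⊕ B) :
  coprod_proj1 A B ∘ t = zero T A -> coprod_proj2 A B ∘ t = zero T B -> factors (iota A B) t.
Proof.
move=> t1 t2; apply: (kernel_lift (kerP _)).
by [apply: pair_ext; rewrite /coprod_to_prod; cat].
Qed.

Lemma comm_le_iota {A B X : C} (f : A ~> X) (g : B ~> X) (D : Sub X) :
  comm_le f g D <-> factors (sub_map D) (copair f g ∘ iota A B).
Proof.
split; first by apply; [exact: iota_proj1 | exact: iota_proj2].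
move=> F T t t1 t2; case: (iota_factors t1 t2) => u ->.
by rewrite comp_assoc; exact: factors_comp.
Qed.

Lemma comm_le_commutator {X : C} (K L D : Sub X) :
  comm_le (sub_map K) (sub_map L) D <-> sub_le (commutator K L) D.
Proof.
have := regular_imageP (copair (sub_map K) (sub_map L) ∘ iota (sub_ob K) (sub_ob L)).
rewrite -/(commutator K L) => im; rewrite comm_le_iota; split.
- case=> h eh; exact: regular_image_le im eh.
- case=> u eu; case: im => e [_ ->]; exists (u ∘ e).
  by rewrite eu comp_assoc.
Qed.

Lemma comm_le_comp {A B A' B' X : C} (f : A ~> X) (g : B ~> X) (a : A' ~> A) (b : B' ~> B)
    (D : Sub X) : comm_le f g D -> comm_le (f ∘ a) (g ∘ b) D.
Proof.
move=> c T t t1 t2.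
have -> : copair (f ∘ a) (g ∘ b) ∘ t = copair f g ∘ (coprod_map a b ∘ t).
  by [rewrite comp_assoc; congr (_ ∘ _); apply: copair_ext; cat].
apply: c; rewrite comp_assoc ?coprod_proj1_map ?coprod_proj2_map -comp_assoc ?t1 ?t2; cat; by [].
Qed.

Lemma comm_le_sym {A B X : C} (f : A ~> X) (g : B ~> X) (D : Sub X) :
  comm_le f g D -> comm_le g f D.
Proof.
move=> c T t t1 t2.
pose s := copair (inr A B) (inl A B).
have -> : copair g f ∘ t = copair f g ∘ (s ∘ t).
  by [rewrite comp_assoc; congr (_ ∘ _); apply: copair_ext; rewrite /s; cat].
apply: c; rewrite comp_assoc.
- suff -> : coprod_proj1 A B ∘ s = coprod_proj2 B A by [].
  by [apply: copair_ext; rewrite /s; cat].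
- suff -> : coprod_proj2 A B ∘ s = coprod_proj1 B A by [].
  by [apply: copair_ext; rewrite /s; cat].
Qed.

(** A commutator depends only on the images of the maps. An element [t] of the kernel
    lifts to [A' ⊕ B], but the lift need not vanish in [A']; its component [x] there is
    killed by [e]. Difunctionality of the relation consisting of the pairs [(y, x)] that
    are images of a common word corrects the lift by [x]. *)
Lemma comm_le_cover {A' A B X : C} (e : A' ~> A) (f : A ~> X) (g : B ~> X) (D : Sub X) :
  cover e -> comm_le (f ∘ e) g D -> comm_le f g D.
Proof.
move=> ce c T t t1 t2.
case: (image_exists (pair (coprod_map e (1_B)) (coprod_proj1 A' B)))
  => R [m [p [mm [cp em]]]].
pose r := fst _ _ ∘ m; pose r' := snd _ _ ∘ m.
have rp : r ∘ p = coprod_map e (1_B) by [rewrite /r -comp_assoc -em; cat].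
have rp' : r' ∘ p = coprod_proj1 A' B by [rewrite /r' -comp_assoc -em; cat].
have mr : mono (pair r r').
  move=> S u v euv; apply: mm; apply: pair_ext.
    by [have := f_equal (fun z => fst _ _ ∘ z) euv; rewrite /r; cat].
  by [have := f_equal (fun z => snd _ _ ∘ z) euv; rewrite /r'; cat].
case: (cover_lift t (coprod_map_cover ce (@cover_id B))) => T1 [c1 [t' [cc1 et']]].
pose x := coprod_proj1 A' B ∘ t'.
have ex : e ∘ x = zero T1 A.
  rewrite /x comp_assoc -(coprod_proj1_map e (1_B)) -comp_assoc et' comp_assoc t1; cat.
  by [].
(* From (t, x), (0, x) and (0, 0) deduce (t, 0). *)
case: (@difunctional _ _ _ _ r r' (p ∘ t') (p ∘ (inl A' B ∘ x)) (zero T1 R) mr).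
    by [rewrite !(comp_assoc r') rp' /x; cat].
  by [rewrite !(comp_assoc r) rp; cat; rewrite ex; cat].
move=> z [z1 z2]; move: z1 z2.
rewrite (comp_assoc r p) rp et' zero_compr => z1 z2.
case: (cover_lift z cp) => T2 [c2 [w [cc2 ew]]].
apply: (cover_local cc1 (@sub_mono _ _ D)); apply: (cover_local cc2 (@sub_mono _ _ D)).
have ew1 : coprod_map e (1_B) ∘ w = t ∘ c1 ∘ c2.
  by rewrite -rp -comp_assoc ew comp_assoc z1.
have -> : copair f g ∘ t ∘ c1 ∘ c2 = copair (f ∘ e) g ∘ w.
  rewrite -!(comp_assoc (copair f g)) -ew1 comp_assoc; congr (_ ∘ _).
  by [apply: copair_ext; cat].
apply: c.
- by [rewrite -rp' -comp_assoc ew comp_assoc z2; cat].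
- rewrite -[LHS]comp_idl comp_assoc -(coprod_proj2_map e) -comp_assoc ew1.
  by [rewrite !comp_assoc t2; cat].
Qed.

Lemma commutator_cover {X : C} (K L : Sub X) :
  exists e : sub_ob K ◇ sub_ob L ~> sub_ob (commutator K L), cover e /\
    copair (sub_map K) (sub_map L) ∘ iota _ _ = sub_map (commutator K L) ∘ e.
Proof.
case: (regular_imageP (copair (sub_map K) (sub_map L) ∘ iota (sub_ob K) (sub_ob L)))
  => e [re ee]; exists e; split => //; exact: regular_epi_cover.
Qed.

(** * Normality of commutators and joins *)

(** Conjugation need only be tested on a cover of the subobject. *)
Lemma conj_closed_cover {X A : C} (H : Sub X) (e : A ~> sub_ob H) : cover e ->
  factors (sub_map H) (copair (1_X) (sub_map H ∘ e) ∘ flat_in X A) ->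
  conj_closed (sub_map H).
Proof.
move=> ce F T t t0.
case: (cover_lift t (coprod_map_cover (@cover_id X) ce)) => T' [c [t' [cc et]]].
apply: (cover_local cc (@sub_mono _ _ H)).
have -> : copair (1_X) (sub_map H) ∘ t ∘ c = copair (1_X) (sub_map H ∘ e) ∘ t'.
  by [rewrite -comp_assoc -et comp_assoc; congr (_ ∘ _); apply: copair_ext; cat].
have [u ->] : factors (flat_in X A) t'.
  apply: (kernel_lift (kerP _)).
  rewrite -[LHS]comp_idl comp_assoc -(coprod_proj1_map (1_X) e) -comp_assoc et comp_assoc t0.
  by cat.
by rewrite comp_assoc; exact: factors_comp.
Qed.

Lemma normal_conj {X : C} (K : Sub X) : normal K ->
  factors (sub_map K) (copair (1_X) (sub_map K) ∘ flat_in X (sub_ob K)).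
Proof. move=> nK; apply: normal_absorbs => //; exact: ker_zero. Qed.

(** Both [K] and [L] are closed under conjugation, and by [flat_jse] conjugates of
    elements of the join are generated by conjugates of elements of [K] and of [L]. *)
Lemma normal_join {X : C} (K L : Sub X) : normal K -> normal L -> normal (join K L).
Proof.
move=> nK nL; apply: conj_closed_normal.
case: (joinP K L) => [[a ea] [[b eb] JU]].
have ce : cover (copair a b).
  move=> W m mm [h eh].
  have mj : mono (sub_map (join K L) ∘ m) by apply: mono_comp => //; exact: sub_mono.
  case: (JU (Build_Sub mj)) => /=.
      exists (h ∘ inl _ _); rewrite ea -(copair1 a b) eh; cat; by [].
    exists (h ∘ inr _ _); rewrite eb -(copair2 a b) eh; cat; by [].
  move=> u eu; apply: split_mono_iso => //; exists u.
  by apply: (@sub_mono _ _ (join K L)); rewrite comp_assoc -eu comp_idr.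
apply: (conj_closed_cover ce).
apply: (jse_local (@flat_jse X (sub_ob K) (sub_ob L)) (@sub_mono _ _ _)).
- case: (normal_conj nK) => u eu; exists (a ∘ u).
  rewrite comp_assoc -ea -eu -comp_assoc flat_mapE comp_assoc; congr (_ ∘ _).
  by [apply: copair_ext; cat; rewrite -?ea].
- case: (normal_conj nL) => u eu; exists (b ∘ u).
  rewrite comp_assoc -eb -eu -comp_assoc flat_mapE comp_assoc; congr (_ ∘ _).
  by [apply: copair_ext; cat; rewrite -?eb].
Qed.


Lemma flat_map_comp (X : C) {A B D : C} (g : B ~> D) (f : A ~> B) :
  flat_map X g ∘ flat_map X f = flat_map X (g ∘ f).
Proof.
apply: (ker_mono (f := coprod_proj1 X D)); rewrite -/(flat_in X D).
rewrite comp_assoc !flat_mapE -comp_assoc flat_mapE comp_assoc; congr (_ ∘ _).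
by [apply: copair_ext; cat].
Qed.

Lemma flat_map_id (X A : C) : flat_map X (1_A) = 1_(flat X A).
Proof.
apply: (ker_mono (f := coprod_proj1 X A)); rewrite -/(flat_in X A) flat_mapE comp_idr.
rewrite -[RHS]comp_idl; congr (_ ∘ _).
by [apply: copair_ext; cat].
Qed.

Lemma flat_map_zero (X A B : C) : flat_map X (zero A B) = zero _ _.
Proof.
apply: (ker_mono (f := coprod_proj1 X B)); rewrite -/(flat_in X B) flat_mapE.
have -> : coprod_map (1_X) (zero A B) = inl X B ∘ coprod_proj1 X A.
  by [apply: copair_ext; cat].
by rewrite -comp_assoc ker_zero !zero_compr.
Qed.

(** Conjugation by [X] maps [K ⊕ L] to [X], to [K] and to [L]. By [flat_jse], what
    results in [X × (K × L)] already lies in the image [I] of [K ⊕ L]. Conjugates of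
    elements of [K ◇ L] have trivial components in [K] and [L], and the elements of [I]
    with this property are those of the commutator. *)
Lemma normal_commutator {X : C} (K L : Sub X) :
  normal K -> normal L -> normal (commutator K L).
Proof.
move=> nK nL; apply: conj_closed_normal.
case: (commutator_cover K L) => e [ce ee].
apply: (conj_closed_cover ce); rewrite -ee.
case: (normal_conj nK) => rK erK; case: (normal_conj nL) => rL erL.
set k := sub_map K in ee erK *; set l := sub_map L in ee erL *.
set K0 := sub_ob K in ee rK erK *; set L0 := sub_ob L in ee rL erL *.
pose th := copair (1_X) (copair k l) ∘ flat_in X (K0 ⊕ L0).
have thE : th = copair (1_X) (copair k l) ∘ flat_in X (K0 ⊕ L0) by [].
clearbody th.
pose om := pair th (pair (rK ∘ flat_map X (coprod_proj1 K0 L0))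
                         (rL ∘ flat_map X (coprod_proj2 K0 L0))).
case: (image_exists (pair (copair k l) (coprod_to_prod K0 L0))) => I [m [e' [mm [ce' em]]]].
have thl : th ∘ flat_map X (inl K0 L0) = k ∘ rK.
  rewrite -erK thE -comp_assoc flat_mapE comp_assoc; congr (_ ∘ _).
  by [apply: copair_ext; cat].
have thr : th ∘ flat_map X (inr K0 L0) = l ∘ rL.
  rewrite -erL thE -comp_assoc flat_mapE comp_assoc; congr (_ ∘ _).
  by [apply: copair_ext; cat].
have [h eh] : factors m om.
{ apply: (jse_local (@flat_jse X K0 L0) mm).
  - exists (e' ∘ (inl K0 L0 ∘ rK)); rewrite comp_assoc -em.
    apply: pair_ext; first by [rewrite /om; cat; rewrite thl].
    rewrite /om /coprod_to_prod; apply: pair_ext; cat; rewrite flat_map_comp; cat.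
    + by [rewrite flat_map_id; cat].
    + by [rewrite flat_map_zero; cat].
  - exists (e' ∘ (inr K0 L0 ∘ rL)); rewrite comp_assoc -em.
    apply: pair_ext; first by [rewrite /om; cat; rewrite thr].
    rewrite /om /coprod_to_prod; apply: pair_ext; cat; rewrite flat_map_comp; cat.
    + by [rewrite flat_map_zero; cat].
    + by rewrite flat_map_id; cat. }
(* Conjugates of elements of [K ◇ L] vanish in [K] and in [L]. *)
pose j := flat_map X (iota K0 L0).
have sj : snd _ _ ∘ (om ∘ j) = zero _ _.
  rewrite /om /j; apply: pair_ext; cat; rewrite flat_map_comp.
    by [rewrite iota_proj1 flat_map_zero; cat].
  by [rewrite iota_proj2 flat_map_zero; cat].
have -> : copair (1_X) (copair k l ∘ iota K0 L0) ∘ flat_in X (K0 ◇ L0) = fst _ _ ∘ (om ∘ j).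
  rewrite /om /j; cat; rewrite thE -comp_assoc flat_mapE comp_assoc; congr (_ ∘ _).
  by [apply: copair_ext; cat].
case: (cover_lift (h ∘ j) ce') => T' [c [t' [cc et]]].
apply: (cover_local cc (@sub_mono _ _ _)).
have ot : om ∘ j ∘ c = pair (copair k l) (coprod_to_prod K0 L0) ∘ t'.
  by rewrite eh em -!comp_assoc et -!comp_assoc.
have -> : fst _ _ ∘ (om ∘ j) ∘ c = copair k l ∘ t'.
  by [rewrite -comp_assoc ot; cat].
have z : coprod_to_prod K0 L0 ∘ t' = zero _ _.
  have := f_equal (fun z => snd _ _ ∘ z) ot.
  by rewrite (comp_assoc _ (om ∘ j)) sj zero_compl pair2A.
have [u ->] : factors (iota K0 L0) t' by apply: (kernel_lift (kerP _)).
by rewrite comp_assoc ee -comp_assoc; exists (e ∘ u).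
Qed.

(** * Commuting maps *)

(** [A ⊕ B -> A × B] is a cover with kernel [A ◇ B]: a map on [A ⊕ B] that kills
    [A ◇ B] descends to the product. *)
Lemma commute_exists {A B X Q : C} (f : A ~> X) (g : B ~> X) (D : Sub X) (q : X ~> Q) :
  q ∘ sub_map D = zero _ Q -> comm_le f g D ->
  exists c : A × B ~> Q, c ∘ pair (1_A) (zero A B) = q ∘ f /\
    c ∘ pair (zero B A) (1_B) = q ∘ g.
Proof.
move=> qD /comm_le_iota [u eu].
have ec : coprod_to_prod A B = copair (pair (1_A) (zero A B)) (pair (zero B A) (1_B)).
  by [apply: copair_ext; apply: pair_ext; rewrite /coprod_to_prod; cat].
have cc : cover (coprod_to_prod A B) by rewrite ec; apply: jse_copair; exact: prod_jse.
have [c e] : exists c, q ∘ copair f g = c ∘ coprod_to_prod A B.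
  apply: cover_cokernel => //.
  by rewrite -/(iota A B) -comp_assoc eu comp_assoc qD zero_compl.
exists c; split.
- have := f_equal (fun z => z ∘ inl A B) e; rewrite ec; cat => ->; by [].
- have := f_equal (fun z => z ∘ inr A B) e; rewrite ec; cat => ->; by [].
Qed.

(** Maps on two points that agree on the base and commute on the kernels extend to
    the product of the points; with the projections to [Y] this is the implication from
    commuting of normal subobjects to centralizing of the corresponding equivalence
    relations. The image [I] of [A ⊕ B] in [P × Q] covers [P]. By [kernel_jse] the
    kernel of [I -> Y] is generated by the kernels of [A] and [B], where the component
    in [Q] is the function [c] of the other two. So an element of [I] vanishing in [P]
    vanishes, [I -> P] is invertible, and [I] is the graph of the extension. *)
Lemma points_commute {Y Q : C} (A B : Pt Y) (alpha : pt_ob A ~> Q) (beta : pt_ob B ~> Q)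
    (c : ker_ob (pt_proj A) × ker_ob (pt_proj B) ~> Q)
    (P : Pullback (pt_proj A) (pt_proj B)) :
  alpha ∘ pt_sec A = beta ∘ pt_sec B ->
  c ∘ pair (1_ _) (zero _ _) = alpha ∘ ker (pt_proj A) ->
  c ∘ pair (zero _ _) (1_ _) = beta ∘ ker (pt_proj B) ->
  exists phi : pb_ob P ~> Q,
    (forall T (x : T ~> pb_ob P), pb2 P ∘ x = pt_sec B ∘ (pt_proj A ∘ (pb1 P ∘ x)) ->
       phi ∘ x = alpha ∘ (pb1 P ∘ x)) /\
    (forall T (x : T ~> pb_ob P), pb1 P ∘ x = pt_sec A ∘ (pt_proj B ∘ (pb2 P ∘ x)) ->
       phi ∘ x = beta ∘ (pb2 P ∘ x)).
Proof.
case: A B alpha beta c P => [A pA sA psA] [B pB sB psB] /= alpha beta c P eab cA cB.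
have ei : pA ∘ 1_A = pB ∘ (sB ∘ pA) by [rewrite comp_assoc psB; cat].
have ej : pA ∘ (sA ∘ pB) = pB ∘ 1_B by [rewrite comp_assoc psA; cat].
pose i := pb_lift P ei; pose j := pb_lift P ej.
have i1 : pb1 P ∘ i = 1_A by exact: pb_lift1.
have i2 : pb2 P ∘ i = sB ∘ pA by exact: pb_lift2.
have j1 : pb1 P ∘ j = sA ∘ pB by exact: pb_lift1.
have j2 : pb2 P ∘ j = 1_B by exact: pb_lift2.
case: (image_exists (copair (pair i alpha) (pair j beta))) => I [m [e [mm [ce em]]]].
pose f := e ∘ inl A B; pose g := e ∘ inr A B.
have mf : m ∘ f = pair i alpha by rewrite /f comp_assoc -em copair1.
have mg : m ∘ g = pair j beta by rewrite /g comp_assoc -em copair2.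
have jfg : jointly_strongly_epic f g.
  apply: copair_jse; suff -> : copair f g = e by [].
  by [apply: copair_ext; cat].
pose n := fst _ _ ∘ m; pose v := snd _ _ ∘ m.
have nf : n ∘ f = i by rewrite /n -comp_assoc mf pair1.
have ng : n ∘ g = j by rewrite /n -comp_assoc mg pair1.
have vf : v ∘ f = alpha by rewrite /v -comp_assoc mf pair2.
have vg : v ∘ g = beta by rewrite /v -comp_assoc mg pair2.
have ext T (x y : T ~> I) : n ∘ x = n ∘ y -> v ∘ x = v ∘ y -> x = y.
  by rewrite /n /v -!comp_assoc => e1 e2; apply: mm; apply: pair_ext.
have ef : e ∘ inl A B = f by [].
have eg : e ∘ inr A B = g by [].
clearbody n v f g i j; clear mf mg.
(* [I] as a point over [Y], with [f] and [g] morphisms of points. *)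
pose pI := pA ∘ (pb1 P ∘ n).
have pIf : pI ∘ f = pA by rewrite /pI -!comp_assoc nf i1 comp_idr.
have pIg : pI ∘ g = pB by rewrite /pI -!comp_assoc ng j1 comp_assoc psA comp_idl.
have fg : g ∘ sB = f ∘ sA.
  apply: ext; rewrite !comp_assoc ?ng ?nf ?vg ?vf ?eab //.
  apply: pb_ext; rewrite !comp_assoc ?i1 ?j1 ?i2 ?j2 -!comp_assoc ?psA ?psB; cat; by [].
have psI : pI ∘ (f ∘ sA) = 1_Y by rewrite comp_assoc pIf.
pose PA : Pt Y := Build_Point psA; pose PB : Pt Y := Build_Point psB.
pose PI : Pt Y := Build_Point psI.
pose F : PA ~> PI := @Build_PointHom C Y PA PI f pIf erefl.
pose G : PB ~> PI := @Build_PointHom C Y PB PI g pIg fg.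
have zf : pI ∘ (f ∘ ker pA) = zero _ _ by rewrite comp_assoc pIf ker_zero.
have zg : pI ∘ (g ∘ ker pB) = zero _ _ by rewrite comp_assoc pIg ker_zero.
have jk := @kernel_jse Y PA PB PI F G (ker_lift zf) (ker_lift zg) jfg
             (ker_liftP zf) (ker_liftP zg).
rewrite /= in jk.
have zA : pA ∘ (pb1 P ∘ n ∘ ker pI) = zero _ _ by rewrite comp_assoc -/pI ker_zero.
have zB : pB ∘ (pb2 P ∘ n ∘ ker pI) = zero _ _.
  by rewrite -zA -!comp_assoc (comp_assoc pA) pb_comm -!comp_assoc.
have claim : v ∘ ker pI = c ∘ pair (ker_lift zA) (ker_lift zB).
{ apply: (jse_epi jk).
  - rewrite -(comp_assoc v) ker_liftP comp_assoc vf -cA -comp_assoc; congr (_ ∘ _).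
    apply: pair_ext; cat; apply: (ker_mono (f := _)); rewrite comp_assoc ker_liftP; cat.
    + by rewrite (comp_assoc n) nf comp_assoc i1 comp_idl.
    + by rewrite (comp_assoc n) nf comp_assoc i2 -comp_assoc ker_zero zero_compr.
  - rewrite -(comp_assoc v) ker_liftP comp_assoc vg -cB -comp_assoc; congr (_ ∘ _).
    apply: pair_ext; cat; apply: (ker_mono (f := _)); rewrite comp_assoc ker_liftP; cat.
    + by rewrite (comp_assoc n) ng comp_assoc j1 -comp_assoc ker_zero zero_compr.
    + by rewrite (comp_assoc n) ng comp_assoc j2 comp_idl. }
have mn : mono n.
{ apply: zero_kernel_mono => T t nt.
  have pt : pI ∘ t = zero _ _ by [rewrite /pI -!comp_assoc nt; cat].
  have uA : ker_lift zA ∘ ker_lift pt = zero _ _.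
    apply: (ker_mono (f := _)); rewrite comp_assoc ker_liftP -!comp_assoc ker_liftP nt; cat.
    by [].
  have uB : ker_lift zB ∘ ker_lift pt = zero _ _.
    apply: (ker_mono (f := _)); rewrite comp_assoc ker_liftP -!comp_assoc ker_liftP nt; cat.
    by [].
  apply: ext; first by rewrite nt zero_compr.
  rewrite -{1}(ker_liftP pt) comp_assoc claim -comp_assoc zero_compr.
  suff -> : pair (ker_lift zA) (ker_lift zB) ∘ ker_lift pt = zero _ _ by cat.
  by apply: pair_ext; rewrite comp_assoc ?pair1 ?pair2 ?uA ?uB zero_compr. }
have cn : cover n.
{ apply: (cover_of_comp (g := e)).
  have -> : n ∘ e = copair i j.
    by apply: copair_ext; rewrite -comp_assoc ?copair1 ?copair2 ?ef ?eg.
  apply: jse_copair; exact: (pullback_jse psA (pbP P) i1 i2 j1 j2). }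
case: (cover_mono_iso cn mn) => r [rn nr].
have key T (x : T ~> pb_ob P) (y : T ~> I) : n ∘ y = x -> v ∘ r ∘ x = v ∘ y.
  by move=> <-; rewrite -!comp_assoc (comp_assoc r) rn comp_idl.
exists (v ∘ r); split => T x ex.
- rewrite (key _ _ (f ∘ (pb1 P ∘ x))); last by rewrite comp_assoc vf.
  rewrite comp_assoc nf; apply: pb_ext; rewrite comp_assoc ?i1 ?i2 ?comp_idl //.
  by rewrite ex -comp_assoc.
- rewrite (key _ _ (g ∘ (pb2 P ∘ x))); last by rewrite comp_assoc vg.
  rewrite comp_assoc ng; apply: pb_ext; rewrite comp_assoc ?j1 ?j2 ?comp_idl //.
  by rewrite ex -comp_assoc.
Qed.


(** * Vanishing of the ternary part *)

Definition flat_sec (K L : C) : L ~> flat K L := ker_lift (coprod_proj1_inr K L).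

Definition flat_proj (K L : C) : flat K L ~> L := coprod_proj2 K L ∘ flat_in K L.

Lemma flat_in_sec (K L : C) : flat_in K L ∘ flat_sec K L = inr K L.
Proof. exact: ker_liftP. Qed.

Lemma flat_proj_sec (K L : C) : flat_proj K L ∘ flat_sec K L = 1_L.
Proof. by rewrite /flat_proj -comp_assoc flat_in_sec; cat. Qed.

Lemma flat_proj_map (K : C) {L M : C} (f : L ~> M) :
  flat_proj K M ∘ flat_map K f = f ∘ flat_proj K L.
Proof. by rewrite /flat_proj -comp_assoc flat_mapE comp_assoc coprod_proj2_map -comp_assoc. Qed.

(** [flat K L] and [S] are points over [L]. On the kernel of the first, [copair k l]
    takes values in [D], on that of the second [s] takes values in [M]; these commute
    modulo [N], so [points_commute] applies. *)
Lemma flat_extend {K L S X Q : C} (k : K ~> X) (l : L ~> X) (s : S ~> X)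
    (p : S ~> L) (i : L ~> S) (D M N : Sub X) (q : X ~> Q)
    (P : Pullback (flat_proj K L) p) :
  p ∘ i = 1_L -> s ∘ i = l -> comm_le k l D -> comm_le (sub_map D) (sub_map M) N ->
  (forall T (t : T ~> S), p ∘ t = zero T L -> factors (sub_map M) (s ∘ t)) ->
  q ∘ sub_map N = zero _ Q ->
  exists phi : pb_ob P ~> Q,
    (forall T (x : T ~> pb_ob P), pb2 P ∘ x = i ∘ (flat_proj K L ∘ (pb1 P ∘ x)) ->
       phi ∘ x = q ∘ (copair k l ∘ (flat_in K L ∘ (pb1 P ∘ x)))) /\
    (forall T (x : T ~> pb_ob P), pb1 P ∘ x = flat_sec K L ∘ (p ∘ (pb2 P ∘ x)) ->
       phi ∘ x = q ∘ (s ∘ (pb2 P ∘ x))).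
Proof.
move=> epi esi cD cN sM qN.
pose A : Pt L := Build_Point (flat_proj_sec K L); pose B : Pt L := Build_Point epi.
have [d ed] : factors (sub_map D) (copair k l ∘ (flat_in K L ∘ ker (flat_proj K L))).
  apply: cD; first by rewrite comp_assoc ker_zero zero_compl.
  exact: (eq_trans (comp_assoc _ _ _) (ker_zero (flat_proj K L))).
have [m em] := sM _ _ (ker_zero p).
case: (commute_exists qN (comm_le_comp d m cN)) => c [c1 c2].
rewrite -ed in c1; rewrite -em in c2.
case: (@points_commute L Q A B (q ∘ (copair k l ∘ flat_in K L)) (q ∘ s) c P).
- by rewrite /= -!comp_assoc flat_in_sec copair2 esi.
- by rewrite c1 /= -!comp_assoc.
- by rewrite c2 /= -!comp_assoc.
- move=> phi [p1 p2]; exists phi; split => T x ex.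
  + by rewrite p1 // -!comp_assoc.
  + by rewrite p2 // -!comp_assoc.
Qed.

(** The core of the theorem. Let [q] have kernel [N], write [J] for
    [flat K (L ⊕ M)], and let [P] be the product, over [L ⊕ M], of the points obtained
    from [flat K L -> L] and [flat K M -> M] by pulling back. The map [J -> Q] induced
    by [k], [l], [m] and [q] factors through the canonical map [psi : J -> P]: the
    factor [phi] is built by three uses of [points_commute], and by [flat_jse] the
    equality [ePhi] is tested on [flat K L] and [flat K M]. The elements [t] of the
    statement lie in [J] and are killed by [psi]. *)
Lemma ternary_le {K X : C} (k : K ~> X) (L M D E N : Sub X) :
  normal L -> normal M -> normal N ->
  comm_le k (sub_map L) D -> comm_le (sub_map D) (sub_map M) N ->
  comm_le k (sub_map M) E -> comm_le (sub_map E) (sub_map L) N ->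
  forall T (t : T ~> K ⊕ (sub_ob L ⊕ sub_ob M)),
    coprod_proj1 _ _ ∘ t = zero _ _ -> coprod_proj2 _ _ ∘ t = zero _ _ ->
    coprod_map (1_K) (coprod_proj1 _ _) ∘ t = zero _ _ ->
    coprod_map (1_K) (coprod_proj2 _ _) ∘ t = zero _ _ ->
    factors (sub_map N) (copair k (copair (sub_map L) (sub_map M)) ∘ t).
Proof.
move=> nL nM [Q [q kq]] cD cDM cE cEL.
have qN := proj1 kq.
set L0 := sub_ob L; set M0 := sub_ob M.
set l := sub_map L; set m := sub_map M.
pose s := copair l m.
case: (sa_pullbacks (flat_proj K L0) (coprod_proj1 L0 M0)) => PL.
case: (sa_pullbacks (flat_proj K M0) (coprod_proj2 L0 M0)) => PM.
case: (@flat_extend K L0 (L0 ⊕ M0) X Q k l s _ (inl L0 M0) D M N q PL).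
  by rewrite coprod_proj1_inl.
  by rewrite /s copair1.
  by [].
  by [].
  by move=> T t t0; apply: normal_absorbs.
  by [].
move=> phiL [phiL1 phiL2].
case: (@flat_extend K M0 (L0 ⊕ M0) X Q k m s _ (inr L0 M0) E L N q PM).
  by rewrite coprod_proj2_inr.
  by rewrite /s copair2.
  by [].
  by [].
  by move=> T t t0; apply: normal_absorbs_r.
  by [].
move=> phiM [phiM1 phiM2].
have eA : flat_proj K L0 ∘ (flat_sec K L0 ∘ coprod_proj1 L0 M0) = coprod_proj1 L0 M0 ∘ 1_ _.
  by [rewrite comp_assoc flat_proj_sec; cat].
have eB : flat_proj K M0 ∘ (flat_sec K M0 ∘ coprod_proj2 L0 M0) = coprod_proj2 L0 M0 ∘ 1_ _.
  by [rewrite comp_assoc flat_proj_sec; cat].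
pose A : Pt (L0 ⊕ M0) := Build_Point (pb_lift2 PL eA).
pose B : Pt (L0 ⊕ M0) := Build_Point (pb_lift2 PM eB).
have zL : flat_proj K L0 ∘ (pb1 PL ∘ ker (pb2 PL)) = zero _ _.
  by rewrite comp_assoc pb_comm -comp_assoc ker_zero zero_compr.
have zM : flat_proj K M0 ∘ (pb1 PM ∘ ker (pb2 PM)) = zero _ _.
  by rewrite comp_assoc pb_comm -comp_assoc ker_zero zero_compr.
(* The kernels of [A] and [B] map to [D] and to [M], which commute modulo [N]. *)
have [d ed] : factors (sub_map D) (copair k l ∘ (flat_in K L0 ∘ (pb1 PL ∘ ker (pb2 PL)))).
  apply: cD; first by rewrite ker_zeroA.
  exact: (eq_trans (comp_assoc _ _ _) zL).
have [e ee] : factors m (copair k m ∘ (flat_in K M0 ∘ (pb1 PM ∘ ker (pb2 PM)))).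
  by apply: normal_absorbs => //; rewrite ker_zeroA.
case: (commute_exists qN (comm_le_comp d e cDM)) => c [c1 c2].
rewrite -ed in c1; rewrite -/m -ee in c2.
case: (sa_pullbacks (pt_proj A) (pt_proj B)) => P.
case: (@points_commute _ Q A B phiL phiM c P).
  rewrite /= phiL2; first by rewrite pb_lift1 pb_lift2 comp_idr.
  rewrite phiM2; first by rewrite pb_lift1 pb_lift2 comp_idr.
  by rewrite !pb_lift2.
  by rewrite /= phiL1 // zL ker_zero zero_compr.
  by rewrite /= phiM1 // zM ker_zero zero_compr.
move=> phi [phi1 phi2].
pose J := flat K (L0 ⊕ M0).
pose a1 : J ~> flat K L0 := flat_map K (coprod_proj1 L0 M0).
pose b1 : J ~> flat K M0 := flat_map K (coprod_proj2 L0 M0).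
pose pS : J ~> L0 ⊕ M0 := flat_proj K (L0 ⊕ M0).
have ea : flat_proj K L0 ∘ a1 = coprod_proj1 L0 M0 ∘ pS by exact: flat_proj_map.
have eb : flat_proj K M0 ∘ b1 = coprod_proj2 L0 M0 ∘ pS by exact: flat_proj_map.
have eab : pt_proj A ∘ pb_lift PL ea = pt_proj B ∘ pb_lift PM eb.
  by rewrite /= !pb_lift2.
pose psi : J ~> pb_ob P := pb_lift P eab.
have psi11 : pb1 PL ∘ (pb1 P ∘ psi) = a1 by rewrite pb_lift1; exact: pb_lift1.
have psi12 : pb2 PL ∘ (pb1 P ∘ psi) = pS by rewrite pb_lift1; exact: pb_lift2.
have psi21 : pb1 PM ∘ (pb2 P ∘ psi) = b1 by rewrite pb_lift2; exact: pb_lift1.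
have psi22 : pb2 PM ∘ (pb2 P ∘ psi) = pS by rewrite pb_lift2; exact: pb_lift2.
clearbody psi.
have ePhi : q ∘ (copair k s ∘ flat_in K (L0 ⊕ M0)) = phi ∘ psi.
{ apply: (jse_epi (@flat_jse K L0 M0)).
  - have x11 : pb1 PL ∘ (pb1 P ∘ (psi ∘ flat_map K (inl L0 M0))) = 1_ _.
      by rewrite !(comp_assoc _ psi) (comp_assoc (pb1 PL)) psi11 /a1 flat_map_comp
           coprod_proj1_inl flat_map_id.
    have x12 : pb2 PL ∘ (pb1 P ∘ (psi ∘ flat_map K (inl L0 M0))) = inl L0 M0 ∘ flat_proj K L0.
      by rewrite !(comp_assoc _ psi) (comp_assoc (pb2 PL)) psi12 /pS flat_proj_map.
    have x21 : pb1 PM ∘ (pb2 P ∘ (psi ∘ flat_map K (inl L0 M0))) = zero _ _.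
      by rewrite !(comp_assoc _ psi) (comp_assoc (pb1 PM)) psi21 /b1 flat_map_comp
           coprod_proj2_inl flat_map_zero.
    have x22 : pb2 PM ∘ (pb2 P ∘ (psi ∘ flat_map K (inl L0 M0))) = inl L0 M0 ∘ flat_proj K L0.
      by rewrite !(comp_assoc _ psi) (comp_assoc (pb2 PM)) psi22 /pS flat_proj_map.
    rewrite -(comp_assoc phi) phi1; last first.
      rewrite phiL1; first by rewrite x11 x12 comp_idr.
      rewrite x11 comp_idr -!comp_assoc flat_mapE (comp_assoc (copair k s)).
      congr (_ ∘ (_ ∘ _)).
      by [rewrite /s; apply: copair_ext; cat].
    rewrite /= x12; apply: pb_ext.
      by [rewrite x21; cat].
    by [rewrite x22; cat].
  - have x21 : pb1 PM ∘ (pb2 P ∘ (psi ∘ flat_map K (inr L0 M0))) = 1_ _.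
      by rewrite !(comp_assoc _ psi) (comp_assoc (pb1 PM)) psi21 /b1 flat_map_comp
           coprod_proj2_inr flat_map_id.
    have x22 : pb2 PM ∘ (pb2 P ∘ (psi ∘ flat_map K (inr L0 M0))) = inr L0 M0 ∘ flat_proj K M0.
      by rewrite !(comp_assoc _ psi) (comp_assoc (pb2 PM)) psi22 /pS flat_proj_map.
    have x11 : pb1 PL ∘ (pb1 P ∘ (psi ∘ flat_map K (inr L0 M0))) = zero _ _.
      by rewrite !(comp_assoc _ psi) (comp_assoc (pb1 PL)) psi11 /a1 flat_map_comp
           coprod_proj1_inr flat_map_zero.
    have x12 : pb2 PL ∘ (pb1 P ∘ (psi ∘ flat_map K (inr L0 M0))) = inr L0 M0 ∘ flat_proj K M0.
      by rewrite !(comp_assoc _ psi) (comp_assoc (pb2 PL)) psi12 /pS flat_proj_map.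
    rewrite -(comp_assoc phi) phi2; last first.
      rewrite phiM1; first by rewrite x21 x22 comp_idr.
      rewrite x21 comp_idr -!comp_assoc flat_mapE (comp_assoc (copair k s)).
      congr (_ ∘ (_ ∘ _)).
      by [rewrite /s; apply: copair_ext; cat].
    rewrite /= x22; apply: pb_ext.
      by [rewrite x11; cat].
    by rewrite x12; cat. }
move=> T t tK tLM tKL tKM.
have [u eu] : factors (flat_in K (L0 ⊕ M0)) t := kernel_lift (kerP _) tK.
have au : a1 ∘ u = zero _ _.
  apply: (ker_mono (f := coprod_proj1 K L0)); rewrite -/(flat_in K L0).
  by rewrite comp_assoc flat_mapE -comp_assoc -eu tKL zero_compr.
have bu : b1 ∘ u = zero _ _.
  apply: (ker_mono (f := coprod_proj1 K M0)); rewrite -/(flat_in K M0).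
  by rewrite comp_assoc flat_mapE -comp_assoc -eu tKM zero_compr.
have su : pS ∘ u = zero _ _ by rewrite /pS /flat_proj -comp_assoc -eu.
have pu : psi ∘ u = zero _ _.
  apply: pb_ext; apply: pb_ext; rewrite !(comp_assoc _ psi).
    by [rewrite (comp_assoc (pb1 PL)) psi11 au; cat].
    by [rewrite (comp_assoc (pb2 PL)) psi12 su; cat].
    by [rewrite (comp_assoc (pb1 PM)) psi21 bu; cat].
    by [rewrite (comp_assoc (pb2 PM)) psi22 su; cat].
apply: (kernel_lift kq).
by rewrite eu (comp_assoc (copair _ _)) (comp_assoc q) ePhi -comp_assoc pu zero_compr.
Qed.

(** * Ternary commutators of maps *)

(** Vanishing in each of the three binary sums is symmetric in the variables, unlike
    the definition of the ternary cosmash product as an iterated kernel. *)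
Definition comm3_le {A B D X : C} (f : A ~> X) (g : B ~> X) (h : D ~> X) (N : Sub X) : Prop :=
  forall T (t : T ~> A ⊕ B ⊕ D),
    coprod_proj1 (A ⊕ B) D ∘ t = zero _ _ ->
    coprod_map (coprod_proj1 A B) (1_D) ∘ t = zero _ _ ->
    coprod_map (coprod_proj2 A B) (1_D) ∘ t = zero _ _ ->
    factors (sub_map N) (copair (copair f g) h ∘ t).

(** Vanishing in [A ⊕ D] entails vanishing in [D], so that [t] lies in
    [(A ⊕ B) ◇ D]; the other two conditions put it in the kernel defining
    [cosmash3]. *)
Lemma iota3_factors {A B D T : C} (t : T ~> A ⊕ B ⊕ D) :
  coprod_proj1 (A ⊕ B) D ∘ t = zero _ _ ->
  coprod_map (coprod_proj1 A B) (1_D) ∘ t = zero _ _ ->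
  coprod_map (coprod_proj2 A B) (1_D) ∘ t = zero _ _ -> factors (iota3 A B D) t.
Proof.
move=> t0 tA tB.
have t2 : coprod_proj2 (A ⊕ B) D ∘ t = zero _ _.
  rewrite -[LHS]comp_idl comp_assoc -(coprod_proj2_map (coprod_proj1 A B)) -comp_assoc tA.
  by rewrite zero_compr.
case: (iota_factors t0 t2) => u eu.
suff [v ev] : factors (ker (cosmash3_map A B D)) u.
  by exists v; rewrite eu ev /iota3 -comp_assoc.
apply: (kernel_lift (kerP _)); rewrite /cosmash3_map.
apply: pair_ext; rewrite comp_assoc ?pair1 ?pair2 zero_compr.
- apply: (ker_mono (f := coprod_to_prod A D)); rewrite -/(iota A D).
  by rewrite comp_assoc cosmash_mapP -comp_assoc -eu tA zero_compr.
- apply: (ker_mono (f := coprod_to_prod B D)); rewrite -/(iota B D).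
  by rewrite comp_assoc cosmash_mapP -comp_assoc -eu tB zero_compr.
Qed.

Lemma comm3_le_iota {A B D X : C} (f : A ~> X) (g : B ~> X) (h : D ~> X) (N : Sub X) :
  comm3_le f g h N <-> factors (sub_map N) (copair (copair f g) h ∘ iota3 A B D).
Proof.
split.
- apply.
  + by rewrite /iota3 comp_assoc iota_proj1 zero_compl.
  + rewrite /iota3 comp_assoc -cosmash_mapP -(pair1 (cosmash_map (coprod_proj1 A B) (1_D))
      (cosmash_map (coprod_proj2 A B) (1_D))) -/(cosmash3_map A B D).
    by rewrite -!comp_assoc ker_zero !zero_compr.
  + rewrite /iota3 comp_assoc -cosmash_mapP -(pair2 (cosmash_map (coprod_proj1 A B) (1_D))
      (cosmash_map (coprod_proj2 A B) (1_D))) -/(cosmash3_map A B D).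
    by rewrite -!comp_assoc ker_zero !zero_compr.
- move=> F T t t0 tA tB; case: (iota3_factors t0 tA tB) => u ->.
  by rewrite comp_assoc; exact: factors_comp.
Qed.

Lemma comm3_le_commutator3 {X : C} (K L M N : Sub X) :
  comm3_le (sub_map K) (sub_map L) (sub_map M) N <-> sub_le (commutator3 K L M) N.
Proof.
have := regular_imageP (copair (copair (sub_map K) (sub_map L)) (sub_map M)
     ∘ iota3 (sub_ob K) (sub_ob L) (sub_ob M)).
rewrite -/(commutator3 K L M) => im; rewrite comm3_le_iota; split.
- case=> h eh; exact: regular_image_le im eh.
- case=> u eu; case: im => e [_ ->]; exists (u ∘ e).
  by rewrite eu comp_assoc.
Qed.

Lemma comm3_le_rot {A B D X : C} (f : A ~> X) (g : B ~> X) (h : D ~> X) (N : Sub X) :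
  comm3_le f g h N -> comm3_le g h f N.
Proof.
move=> c T t t0 tB tD.
pose r := copair (copair (inl (A ⊕ B) D ∘ inr A B) (inr (A ⊕ B) D))
  (inl (A ⊕ B) D ∘ inl A B).
have -> : copair (copair g h) f ∘ t = copair (copair f g) h ∘ (r ∘ t).
  rewrite comp_assoc; congr (_ ∘ _).
  by [apply: copair_ext; first apply: copair_ext; rewrite /r; cat].
have e1 : coprod_proj1 (A ⊕ B) D ∘ r
    = copair (inr A B) (inl A B) ∘ coprod_map (coprod_proj1 B D) (1_A).
  by [apply: copair_ext; first apply: copair_ext; rewrite /r; cat].
have e2 : coprod_map (coprod_proj1 A B) (1_D) ∘ r =
   copair (inr A D) (inl A D) ∘ coprod_map (coprod_proj2 B D) (1_A).
  by [apply: copair_ext; first apply: copair_ext; rewrite /r; cat].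
have e3 : coprod_map (coprod_proj2 A B) (1_D) ∘ r = coprod_proj1 (B ⊕ D) A.
  by [apply: copair_ext; first apply: copair_ext; rewrite /r; cat].
apply: c; rewrite comp_assoc ?e1 ?e2 ?e3 -?comp_assoc ?tB ?tD ?t0 ?zero_compr; by [].
Qed.

(** [(K ◇ L) ◇ D] maps to the ternary cosmash product, because killing [K] or [L]
    kills [K ◇ L]. *)
Lemma comm3_le_comm {X D : C} (K L N : Sub X) (h : D ~> X) :
  comm3_le (sub_map K) (sub_map L) h N -> comm_le (sub_map (commutator K L)) h N.
Proof.
move=> c; case: (commutator_cover K L) => e [ce ee].
apply: (comm_le_cover ce); rewrite -ee => T t t1 t2.
set i := iota _ _.
have -> : copair (copair (sub_map K) (sub_map L) ∘ i) h ∘ t =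
  copair (copair (sub_map K) (sub_map L)) h ∘ (coprod_map i (1_D) ∘ t).
  by [rewrite comp_assoc; congr (_ ∘ _); apply: copair_ext; cat].
apply: c.
- by rewrite comp_assoc coprod_proj1_map -comp_assoc t1 zero_compr.
- have -> : coprod_map (coprod_proj1 _ _) (1_D) ∘ (coprod_map i (1_D) ∘ t)
     = inr _ _ ∘ (coprod_proj2 _ _ ∘ t).
    rewrite !comp_assoc; congr (_ ∘ _).
    by [apply: copair_ext; cat; rewrite ?/i ?iota_proj1; cat].
  by rewrite t2 zero_compr.
- have -> : coprod_map (coprod_proj2 _ _) (1_D) ∘ (coprod_map i (1_D) ∘ t)
     = inr _ _ ∘ (coprod_proj2 _ _ ∘ t).
    rewrite !comp_assoc; congr (_ ∘ _).
    by [apply: copair_ext; cat; rewrite ?/i ?iota_proj2; cat].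
  by rewrite t2 zero_compr.
Qed.

Lemma sub_le_refl {X : C} (A : Sub X) : sub_le A A.
Proof. by exists (1_ _); rewrite comp_idr. Qed.

Lemma sub_le_trans {X : C} (A B D : Sub X) : sub_le A B -> sub_le B D -> sub_le A D.
Proof. by case=> a ea [b eb]; exists (b ∘ a); rewrite ea eb comp_assoc. Qed.

Lemma commutator3_le {X : C} (K L M : Sub X) : normal K -> normal L -> normal M ->
  sub_le (commutator3 K L M)
    (join (commutator (commutator K L) M) (commutator (commutator M K) L)).
Proof.
move=> nK nL nM; set N := join _ _.
have [le1 [le2 _]] := joinP (commutator (commutator K L) M) (commutator (commutator M K) L).
have nN : normal N by apply: normal_join; apply: normal_commutator => //; apply: normal_commutator.
apply/comm3_le_commutator3 => T t t0 tK tL.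
set k := sub_map K in t t0 tK tL *.
pose r := copair (copair (inl _ _) (inr (sub_ob K) _ ∘ inl _ _))
  (inr (sub_ob K) _ ∘ inr (sub_ob L) (sub_ob M)).
have -> : copair (copair k (sub_map L)) (sub_map M) ∘ t =
    copair k (copair (sub_map L) (sub_map M)) ∘ (r ∘ t).
  rewrite comp_assoc; congr (_ ∘ _).
  by [apply: copair_ext; first apply: copair_ext; rewrite /r; cat].
have e1 : coprod_map (1_ _) (coprod_proj1 _ _) ∘ r = coprod_proj1 _ _.
  by [apply: copair_ext; first apply: copair_ext; rewrite /r; cat].
have e2 : coprod_map (1_ _) (coprod_proj2 _ _) ∘ r = coprod_map (coprod_proj1 _ _) (1_ _).
  by [apply: copair_ext; first apply: copair_ext; rewrite /r; cat].
have e3 : coprod_proj2 _ _ ∘ r = coprod_map (coprod_proj2 _ _) (1_ _).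
  by [apply: copair_ext; first apply: copair_ext; rewrite /r; cat].
have e4 : coprod_proj1 _ _ ∘ r = coprod_proj1 _ _ ∘ coprod_proj1 _ _.
  by [apply: copair_ext; first apply: copair_ext; rewrite /r; cat].
apply: (@ternary_le _ _ k L M (commutator K L) (commutator M K) N) => //.
- by apply/comm_le_commutator; exact: sub_le_refl.
- by apply/comm_le_commutator.
- by apply: comm_le_sym; apply/comm_le_commutator; exact: sub_le_refl.
- by apply/comm_le_commutator.
- by rewrite comp_assoc e4 -comp_assoc t0 zero_compr.
- by rewrite comp_assoc e3.
- by rewrite comp_assoc e1.
- by rewrite comp_assoc e2.
Qed.

End Coherent.

Lemma commutator_le_commutator3 {X : C} (K L M : Sub X) :
  sub_le (commutator (commutator K L) M) (commutator3 K L M).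
Proof.
apply/comm_le_commutator; apply: comm3_le_comm; apply/comm3_le_commutator3.
exact: sub_le_refl.
Qed.

Lemma commutator3_rot {X : C} (K L M : Sub X) :
  sub_le (commutator3 L M K) (commutator3 K L M).
Proof.
apply/comm3_le_commutator3/comm3_le_rot/comm3_le_commutator3.
exact: sub_le_refl.
Qed.

End ThreeSubobjects.

Theorem theorem7p1 (C : SemiAbelianCategory) (HC : algebraically_coherent C)
    (X : C) (K L M : Sub X) (HK : normal K) (HL : normal L) (HM : normal M) :
  sub_eq (commutator3 K L M)
    (join (commutator (commutator K L) M) (commutator (commutator M K) L)) /\
  sub_le (commutator (commutator L M) K)
    (join (commutator (commutator K L) M) (commutator (commutator M K) L)).
Proof.
have le3 := commutator3_le HC HK HL HM.
split; first split => //.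
- case: (joinP (commutator (commutator K L) M) (commutator (commutator M K) L)) => _ [_ least].
  apply: least; first exact: commutator_le_commutator3.
  apply: sub_le_trans (commutator_le_commutator3 M K L) _.
  exact: sub_le_trans (commutator3_rot L M K) (commutator3_rot K L M).
- apply: sub_le_trans le3.
  exact: sub_le_trans (commutator_le_commutator3 L M K) (commutator3_rot K L M).
Qed.
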